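(* Let $D$ be a long virtual knot diagram with at least one classical crossing, and let $k$ be the number of virtual crossings of $D$. If $\deg_s\zeta(D)=k$, then $D$ has minimal virtual crossing number; that is, every long virtual knot diagram equivalent to $D$ has at least $k$ virtual crossings.
   Context: **Long virtual knots.** A long virtual knot diagram is a smooth immersion $f:\mathbb{R}\to\mathbb{R}^2$ such that (1) outside some big circle $f(t)=(t,0)$; (2) each intersection point is double and transverse; (3) each intersection point is endowed either with a classical crossing structure (a choice of overpass and underpass) or with a virtual crossing structure. The diagram is oriented by increasing $t$. Two diagrams are equivalent, i.e. represent the same long virtual knot, if they are related by planar isotopy and a finite sequence of generalized Reidemeister moves: the classical moves $\Omega_1,\Omega_2,\Omega_3$, their purely virtual versions $\Omega_1',\Omega_2',\Omega_3'$, and the semivirtual move $\Omega'$ (a third move with one classical and two virtual crossings, moving a strand with two consecutive virtual crossings past a classical crossing). **Arcs and long arcs.** An arc of a diagram is a connected component of the set obtained from the diagram by deleting all virtual crossings, where at each classical crossing the two undercrossing edges are regarded as disjoint from each other (as usually drawn), while the overcrossing strand is not broken. Two arcs $a,a'$ belong to the same long arc if there are arcs $a=a_1,\dots,a_{m+1}=a'$ and virtual crossings $c_1,\dots,c_m$ such that $a_i,a_{i+1}$ are incident to $c_i$ from opposite sides for $i=1,\dots,m$. The initial long arc $\gamma_-$ (coming from $t=-\infty$) and the final long arc $\gamma_+$ (going to $t=+\infty$) are regarded as forming one united long arc $\gamma=\gamma_-\cup\gamma_+$, traversed along $\gamma_+$ first and then along $\gamma_-$. Hence, for a diagram $D$ with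 $n\ge 1$ classical crossings, there are exactly $n$ long arcs, and each classical crossing $v$ is paired with the long arc emanating from $v$ (the one starting at the outgoing underpass edge at $v$). Number the classical crossings $v_1,\dots,v_n$ in any way and let $\gamma^j$ be the long arc emanating from $v_j$. **Early over/undercrossings.** A classical crossing $v$ is an early overcrossing (respectively early undercrossing) if, traversing the diagram by increasing $t$, the first passage through $v$ is along its overpass (respectively underpass). **Incidence coefficients.** Let $T=\mathbb{Z}[p,p^{-1},q,q^{-1}]/\big((p-1)(p-q),\,(q-1)(p-q)\big)$. For a classical crossing $v$ and an arc $a$, define $$[v:a]=\varepsilon_1\cdot 1+\varepsilon_2\,(t^{\operatorname{sgn} v}-1)+\varepsilon_3\,(-t^{\operatorname{sgn} v})\in T,$$ where $t=p$ if $v$ is an early overcrossing and $t=q$ if $v$ is an early undercrossing; $\operatorname{sgn} v\in\{\pm1\}$ is the local writhe number of $v$; and $\varepsilon_i\in\{0,1\}$ with $\varepsilon_1=1$ iff $a$ emanates from $v$ (outgoing underpass edge), $\varepsilon_2=1$ iff $a$ passes over $v$, $\varepsilon_3=1$ iff $a$ comes into $v$ (incoming underpass edge). If $v$ and $a$ are not incident, $[v:a]=0$. **Degrees of arcs.** The function $\deg:\{\text{arcs of }D\}\to\mathbb{Z}$ is defined by: (1) $\deg a=0$ if $a$ is the first arc of its long arc; (2) if $a,b$ are neighbouring arcs on a long arc, separated by a virtual crossing, with $a$ preceding $b$, then $\deg b=\deg a+1$ if passing from $a$ to $b$ one crosses the (oriented) transversal strand from its left to its right, and $\deg b=\deg a-1$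 otherwise. For the united long arc $\gamma$, the first arc is the first arc of $\gamma_+$, and the last arc of $\gamma_+$ and the first arc of $\gamma_-$ have the same degree. **The polynomial.** Let $A(D)$ be the $n\times n$ matrix with entries $$A_{ij}=\sum_{a\subset\gamma^j}[v_i:a]\,s^{\deg a}\in T[s,s^{-1}],$$ the sum running over the arcs $a$ contained in $\gamma^j$, and put $\zeta(D)=\det A(D)\in T[s,s^{-1}]$. This does not depend on the numbering of the classical crossings. For a nonzero element of $T[s,s^{-1}]$, $\deg_s$ denotes the largest exponent of $s$ occurring with nonzero coefficient in $T$; the zero polynomial has degree $-\infty$. *)

(* Defs.v *)
From HB Require Import structures.
From mathcomp Require Import all_boot all_order all_algebra.
From mathcomp Require Import boolp finmap monalg.
From Stdlib Require Import Relation_Operators.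

Set Implicit Arguments.
Unset Strict Implicit.
Unset Printing Implicit Defensive.

Import GRing.Theory.
Local Open Scope ring_scope.

Definition ideal2 (A : comNzRingType) (x y : A) : {pred A} :=
  fun z => `[< exists a b : A, z = a * x + b * y >].

Lemma ideal2_closed (A : comNzRingType) (x y : A) :
  1 \notin ideal2 x y -> idealr_closed (ideal2 x y).
Proof.
move=> proper; split=> //.
  by apply/asboolP; exists 0, 0; rewrite !mul0r addr0.
move=> z u v /asboolP [a [b ->]] /asboolP [c [d ->]].
apply/asboolP; exists (z * a + c), (z * b + d).
by rewrite mulrDr !mulrDl !mulrA addrACA.
Qed.

(* ---------------------------------------------------------------------- *)
(* The group algebra R[K] of an additive abelian group K: finitely         *)
(* supported functions K -> R with convolution.  [malg] supplies the       *)
(* Z-module structure for any choiceType K, but its product requires a     *)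
(* monoid without nontrivial units, which excludes K = int.                *)
(* K = int gives R[s, s^-1] and K = int * int gives R[p, p^-1, q, q^-1];   *)
(* << c *g k >> is the monomial of exponent k and coefficient c, and       *)
(* f @_ k is the coefficient of f at the exponent k.                       *)

Definition galg (K : zmodType) (R : comNzRingType) := {malg R[K]}.

HB.instance Definition _ (K : zmodType) (R : comNzRingType) :=
  GRing.Zmodule.on (galg K R).

Section GroupAlgebra.
Variables (K : zmodType) (R : comNzRingType).
Local Open Scope fset_scope.
Local Open Scope ring_scope.
Implicit Types f g h : galg K R.

Definition galg_one : galg K R := << 1 *g (0 : K) >>.

(* Locked to keep conversion from unfolding products. *)
Fact galg_mul_key : unit. Proof. by []. Qed.

Definition galg_mul : galg K R -> galg K R -> galg K R :=
  locked_with galg_mul_key (fun f g =>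
    \sum_(i <- msupp f) \sum_(j <- msupp g) << f@_i * g@_j *g i + j >>).

Lemma galg_mulE f g : galg_mul f g =
  \sum_(i <- msupp f) \sum_(j <- msupp g) << f@_i * g@_j *g i + j >>.
Proof. by rewrite /galg_mul unlock. Qed.

Lemma galg_mulw (d1 d2 : {fset K}) f g :
  msupp f `<=` d1 -> msupp g `<=` d2 ->
  galg_mul f g = \sum_(i <- d1) \sum_(j <- d2) << f@_i * g@_j *g i + j >>.
Proof.
move=> le_d1 le_d2; rewrite galg_mulE (big_fset_incl _ le_d1) /=.
  apply/eq_bigr=> i _; apply/big_fset_incl => // j _ /mcoeff_outdom ->.
  by rewrite mulr0 monalgU0.
move=> i _ /mcoeff_outdom fi0.
by rewrite big1 => // j _; rewrite fi0 mul0r monalgU0.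
Qed.

Lemma galg_mulC : commutative galg_mul.
Proof.
move=> f g; rewrite !galg_mulE exchange_big /=.
apply/eq_bigr=> i _; apply/eq_bigr=> j _.
by rewrite mulrC [in LHS]addrC.
Qed.

Lemma galg_mulDl : left_distributive galg_mul +%R.
Proof.
move=> f g h.
rewrite (galg_mulw (msuppD_le f g) (fsubset_refl (msupp h))).
rewrite (galg_mulw (fsubsetUl (msupp f) (msupp g)) (fsubset_refl (msupp h))).
rewrite (galg_mulw (fsubsetUr (msupp f) (msupp g)) (fsubset_refl (msupp h))).
rewrite -big_split /=; apply/eq_bigr=> i _.
rewrite -big_split /=; apply/eq_bigr=> j _.
by rewrite mcoeffD mulrDl monalgUD.
Qed.

Lemma galg_mulDr : right_distributive galg_mul +%R.
Proof. by move=> f g h; rewrite !(galg_mulC f) galg_mulDl. Qed.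

Lemma galg_mul0 : left_zero 0 galg_mul.
Proof. by move=> f; rewrite galg_mulE msupp0 big_seq_fset0. Qed.

Lemma galg_mulr0 : right_zero 0 galg_mul.
Proof. by move=> f; rewrite galg_mulC galg_mul0. Qed.

Lemma galg_mulUU (c d : R) (i j : K) :
  galg_mul << c *g i >> << d *g j >> = << c * d *g i + j >>.
Proof. by rewrite (galg_mulw msuppU_le msuppU_le) !big_seq_fset1 !mcoeffUU. Qed.

Lemma galgE f : f = \sum_(i <- msupp f) (<< f@_i *g i >> : galg K R).
Proof. exact: monalgE. Qed.

Lemma galg_mulA : associative galg_mul.
Proof.
have mul_suml (I : Type) (s : seq I) (F : I -> galg K R) g :
    galg_mul (\sum_(i <- s) F i) g = \sum_(i <- s) galg_mul (F i) g.
  exact: (big_morph (galg_mul^~ g) (fun _ _ => galg_mulDl _ _ _) (galg_mul0 g)).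
have mul_sumr (I : Type) (s : seq I) (F : I -> galg K R) g :
    galg_mul g (\sum_(i <- s) F i) = \sum_(i <- s) galg_mul g (F i).
  exact: (big_morph (galg_mul g) (fun _ _ => galg_mulDr _ _ _) (galg_mulr0 g)).
move=> f g h; rewrite [f]galgE 3!mul_suml; apply/eq_bigr=> i _.
rewrite [g]galgE mul_suml !mul_sumr mul_suml; apply/eq_bigr=> j _.
rewrite [h]galgE !mul_sumr; apply/eq_bigr=> k _.
by rewrite !galg_mulUU mulrA addrA.
Qed.

Lemma galg_mul1 : left_id galg_one galg_mul.
Proof.
move=> f; rewrite [f in LHS]galgE.
rewrite (big_morph (galg_mul galg_one) (fun _ _ => galg_mulDr _ _ _) (galg_mulr0 _)).
rewrite [RHS]galgE; apply/eq_bigr=> i _.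
by rewrite galg_mulUU mul1r add0r.
Qed.

Lemma galg_one_neq0 : galg_one != 0.
Proof. by rewrite monalgU_eq0 oner_eq0. Qed.

HB.instance Definition _ := GRing.Zmodule_isComNzRing.Build (galg K R)
  galg_mulA galg_mulC galg_mul1 galg_mulDl galg_one_neq0.

(* The augmentation, which sends every monomial of coefficient c to c. *)
Definition galg_aug f : R := \sum_(i <- msupp f) f@_i.

Lemma galg_augw (d : {fset K}) f : msupp f `<=` d -> galg_aug f = \sum_(i <- d) f@_i.
Proof. by move=> le; apply: big_fset_incl => // i _ /mcoeff_outdom. Qed.

Lemma galg_augD : {morph galg_aug : f g / f + g}.
Proof.
move=> f g; rewrite (galg_augw (msuppD_le f g)).
rewrite (galg_augw (fsubsetUl (msupp f) (msupp g))).
rewrite (galg_augw (fsubsetUr (msupp f) (msupp g))) -big_split /=.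
by apply/eq_bigr=> i _; rewrite mcoeffD.
Qed.

Lemma galg_augU c i : galg_aug << c *g i >> = c.
Proof. by rewrite (galg_augw msuppU_le) big_seq_fset1 mcoeffUU. Qed.

Lemma galg_aug0 : galg_aug 0 = 0.
Proof. by rewrite /galg_aug msupp0 big_seq_fset0. Qed.

Lemma galg_augM : {morph galg_aug : f g / f * g}.
Proof.
move=> f g; rewrite {1}/GRing.mul /= galg_mulE (big_morph _ galg_augD galg_aug0).
rewrite /galg_aug mulr_suml; apply/eq_bigr=> i _.
rewrite -/(galg_aug _) (big_morph _ galg_augD galg_aug0) mulr_sumr.
by apply/eq_bigr=> j _; rewrite galg_augU.
Qed.

Lemma galg_aug1 : galg_aug 1 = 1.
Proof. exact: galg_augU. Qed.

Lemma galg_ideal2_proper f g h : galg_aug h = 0 -> 1 \notin ideal2 (f * h) (g * h).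
Proof.
move=> h0; apply/negP => /asboolP [a [b e]]; move: (oner_neq0 R).
by rewrite -galg_aug1 e galg_augD !galg_augM h0 !mulr0 addr0 eqxx.
Qed.

End GroupAlgebra.

(* ---------------------------------------------------------------------- *)
(* T = Z[p, p^-1, q, q^-1] / ((p - 1)(p - q), (q - 1)(p - q)).             *)

Definition zpq : comNzRingType := galg (int * int)%type int.

Definition zpq_p : zpq := << 1 *g ((1, 0) : int * int) >>.
Definition zpq_q : zpq := << 1 *g ((0, 1) : int * int) >>.

Definition T_ideal : {pred zpq} :=
  ideal2 ((zpq_p - 1) * (zpq_p - zpq_q)) ((zpq_q - 1) * (zpq_p - zpq_q)).

Lemma T_ideal_proper : 1 \notin T_ideal.
Proof.
apply: galg_ideal2_proper; apply: (addIr (galg_aug zpq_q)).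
rewrite -galg_augD subrK add0r.
by transitivity (1 : int); [|symmetry]; exact: galg_augU.
Qed.

HB.instance Definition _ :=
  isIdealr.Build zpq T_ideal (ideal2_closed T_ideal_proper).

Definition T : comNzRingType := {ideal_quot T_ideal}.

Definition toT : zpq -> T := (\pi_({ideal_quot T_ideal}))%qT.

Definition T_p (e : int) : T := toT << 1 *g ((e, 0) : int * int) >>.
Definition T_q (e : int) : T := toT << 1 *g ((0, e) : int * int) >>.

Definition is_deg_s (f : galg int T) (d : int) : Prop :=
  f@_d != 0 /\ forall e : int, (d < e)%R -> f@_e = 0.

(* ---------------------------------------------------------------------- *)
(* Long virtual knot diagrams, up to planar isotopy.  Following the curve  *)
(* from t = -oo to t = +oo, one records the successive passages through    *)
(* crossings.  The one-point compactification of the diagram is a          *)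
(* connected immersed curve on the sphere with the base point at infinity, *)
(* so its planar isotopy class is determined by this word, up to renaming  *)
(* the crossings, and the words that occur are those of genus 0.           *)

Inductive level := Over | Under | Virtual.

Definition level_code (l : level) : option bool :=
  match l with Over => Some true | Under => Some false | Virtual => None end.
Definition level_decode (o : option bool) : level :=
  match o with Some true => Over | Some false => Under | None => Virtual end.
Lemma level_codeK : cancel level_code level_decode. Proof. by case. Qed.
HB.instance Definition _ := Equality.copy level (can_type level_codeK).

(* [l2r]: this passage crosses the other, oriented strand of its crossing  *)
(* from the left of that strand to its right.                              *)
Record passage := Passage {label : nat; lev : level; l2r : bool}.

Definition opp_level (l : level) : level :=
  match l with Over => Under | Under => Over | Virtual => Virtual end.

(* The other passage through the same crossing: of two transverse strands, *)
(* exactly one crosses the other from left to right.                       *)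
Definition mate (x : passage) : passage :=
  Passage (label x) (opp_level (lev x)) (~~ l2r x).

Definition matched (x y : passage) : bool :=
  [&& label y == label x, lev y == opp_level (lev x) & l2r y == ~~ l2r x].

Definition well_formed (w : seq passage) : bool :=
  all (fun x => if [seq y <- w | label y == label x] is [:: a; b]
                then matched a b else false) w.

Section Faces.
Variable w : seq passage.

Definition pass_at (i : 'I_(size w)) : passage := tnth (in_tuple w) i.

Definition mate_pos (i : 'I_(size w)) : 'I_(size w) :=
  odflt i [pick j | (j != i) && (label (pass_at j) == label (pass_at i))].

(* The dart (i, b) leaves passage i, forwards if b and backwards if ~~ b,  *)
(* along an edge of the curve on the sphere; the edge from the last        *)
(* passage to the first one runs through infinity.  [face_step] walks this *)
(* edge and turns to the leftmost strand at its end, keeping the same face *)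
(* on the left.                                                            *)
Definition face_step (d : 'I_(size w) * bool) : 'I_(size w) * bool :=
  let k := if d.2 then ordS d.1 else ord_pred d.1 in
  (mate_pos k, l2r (pass_at k) == d.2).

Definition num_faces : nat := fcard face_step {: 'I_(size w) * bool}.

(* Euler characteristic 2, with size w edges and (size w)./2 vertices. *)
Definition planar : bool :=
  nilp w || ((size w)./2 + num_faces == size w + 2)%N.

End Faces.

Record diagram := Diagram {
  code : seq passage;
  codeP : well_formed code && planar code
}.

(* ---------------------------------------------------------------------- *)
(* Generalized Reidemeister moves.                                         *)

Definition rename (f : nat -> nat) (x : passage) : passage :=
  Passage (f (label x)) (lev x) (l2r x).

Definition in_order (o : bool) (x y : passage) : seq passage :=
  if o then [:: x; y] else [:: y; x].

(* In a third move three short segments 1, 2, 3 of the curve, numbered in  *)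
(* the order of traversal, meet pairwise at crossings with passages        *)
(*   u : segment 1 with 2,  v : segment 1 with 3,  x : segment 2 with 3,   *)
(* [u], [v] on segment 1, [mate u], [x] on segment 2, and [mate v],        *)
(* [mate x] on segment 3, in the orders given by the booleans.             *)
(* [on_left y first]: seen from the strand that crosses passage y, the     *)
(* rest of the segment of y lies on the left, where [first] tells whether  *)
(* y is the first of the two passages of its segment.                      *)
Definition on_left (y : passage) (first : bool) : bool := first (+) l2r y.

(* The segments bound a triangular face when the two segments that cross   *)
(* any given one leave it on the same side.                                *)
Definition triangle (o1 o2 o3 : bool) (u v x : passage) : bool :=
  [&& on_left (mate u) o2 == on_left (mate v) o3,
      on_left u o1 == on_left (mate x) (~~ o3)
    & on_left v (~~ o1) == on_left x (~~ o2)].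

(* No virtual crossing (then some segment is above the two others), all    *)
(* three, or exactly two, which then lie on one segment; not exactly one.  *)
Definition third_move_levels (u v x : passage) : bool :=
  match count (fun y => lev y == Virtual) [:: u; v; x] with
  | 0 => [|| (lev u == Over) && (lev v == Over),
             (lev (mate u) == Over) && (lev x == Over)
           | (lev (mate v) == Over) && (lev (mate x) == Over)]
  | 1 => false
  | _ => true
  end.

Inductive move : seq passage -> seq passage -> Prop :=
| Rename (f : nat -> nat) w : injective f -> move w (map (rename f) w)
| Omega1 x w1 w2 : move (w1 ++ w2) (w1 ++ [:: x; mate x] ++ w2)
| Omega2 (parallel : bool) x y w1 w2 w3 :
    lev x = lev y -> l2r x <> l2r y ->
    move (w1 ++ w2 ++ w3)
         (w1 ++ [:: x; y] ++ w2 ++ in_order parallel (mate x) (mate y) ++ w3)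
| Omega3 (o1 o2 o3 : bool) u v x w1 w2 w3 w4 :
    triangle o1 o2 o3 u v x -> third_move_levels u v x ->
    move (w1 ++ in_order o1 u v ++ w2 ++ in_order o2 (mate u) x
             ++ w3 ++ in_order o3 (mate v) (mate x) ++ w4)
         (w1 ++ in_order (~~ o1) u v ++ w2 ++ in_order (~~ o2) (mate u) x
             ++ w3 ++ in_order (~~ o3) (mate v) (mate x) ++ w4).

Definition equivalent : diagram -> diagram -> Prop :=
  clos_refl_sym_trans diagram (fun D D' => move (code D) (code D')).

(* ---------------------------------------------------------------------- *)
(* Crossings.                                                              *)

Definition at_level (l : level) (v : nat) (x : passage) : bool :=
  (lev x == l) && (label x == v).

Definition under_labels (w : seq passage) : seq nat :=
  [seq label x | x <- w & lev x == Under].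

Definition classical_crossings (D : diagram) : seq nat := under_labels (code D).

Definition virtual_crossings (D : diagram) : seq nat :=
  undup [seq label x | x <- code D & lev x == Virtual].

Definition num_virtual (D : diagram) : nat := size (virtual_crossings D).

Definition early_over (D : diagram) (v : nat) : bool :=
  (find (at_level Over v) (code D) < find (at_level Under v) (code D))%N.

(* The local writhe number is positive exactly when the overpass crosses   *)
(* the underpass from left to right.                                       *)
Definition writhe (D : diagram) (v : nat) : int :=
  if has (fun x => at_level Over v x && l2r x) (code D) then 1 else -1.

(* ---------------------------------------------------------------------- *)
(* Arcs are numbered in the order of traversal: the arc a runs from the    *)
(* end of the (a-1)st to the a-th (counting from 0) passage that is under  *)
(* or virtual, the first coming from -oo and the last going to +oo.        *)

Definition breaks (D : diagram) : seq passage :=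
  [seq x <- code D | lev x != Over].

Definition diag_arc (D : diagram) := 'I_(size (breaks D)).+1.

Definition emanates (D : diagram) (v : nat) (a : diag_arc D) : bool :=
  a == (find (at_level Under v) (breaks D)).+1 :> nat.

Definition comes_into (D : diagram) (v : nat) (a : diag_arc D) : bool :=
  a == find (at_level Under v) (breaks D) :> nat.

Definition passes_over (D : diagram) (v : nat) (a : diag_arc D) : bool :=
  a == count (fun x => lev x != Over)
         (take (find (at_level Over v) (code D)) (code D)) :> nat.

(* The classical crossing from which the long arc containing a emanates:   *)
(* the last undercrossing before a, or, on gamma_-, the last one of all,   *)
(* which starts gamma_+.                                                   *)
Definition long_arc_source (D : diagram) (a : diag_arc D) : nat :=
  last (last 0%N (under_labels (breaks D)))
       (under_labels (take a (breaks D))).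

(* The effect on the degree of passing from an arc to the next one.        *)
Definition next_deg (d : int) (x : passage) : int :=
  match lev x with
  | Under => 0
  | Virtual => if l2r x then d + 1 else d - 1
  | Over => d
  end.

(* The degree of the last arc of gamma_+, hence of the first arc of        *)
(* gamma_-; the start value 0 is irrelevant if there is an undercrossing.  *)
Definition deg_at_infinity (D : diagram) : int := foldl next_deg 0 (breaks D).

Definition arc_deg (D : diagram) (a : diag_arc D) : int :=
  foldl next_deg (deg_at_infinity D) (take a (breaks D)).

(* ---------------------------------------------------------------------- *)
(* The polynomial zeta, for a numbering v of the classical crossings.      *)

Definition t_pow (D : diagram) (v : nat) : T :=
  if early_over D v then T_p (writhe D v) else T_q (writhe D v).

Definition incidence (D : diagram) (v : nat) (a : diag_arc D) : T :=
  (emanates v a)%:R * 1 + (passes_over v a)%:R * (t_pow D v - 1)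
  + (comes_into v a)%:R * (- t_pow D v).

Definition zeta_matrix (D : diagram) (n : nat) (v : n.-tuple nat) :
    'M[galg int T]_n :=
  \matrix_(i, j) \sum_(a : diag_arc D | long_arc_source a == tnth v j)
    << incidence (tnth v i) a *g arc_deg a >>.

Definition zeta (D : diagram) (n : nat) (v : n.-tuple nat) : galg int T :=
  \det (zeta_matrix D v).

(* Main.v *)
From HB Require Import structures.
Require Import Defs.
From mathcomp Require Import all_boot all_order all_algebra all_fingroup ring.
From mathcomp Require Import boolp finmap monalg.

(* Attach an unknown to the edge leaving every passage of the word, infinity   *)
(* included, and to every passage the local relation between its outgoing and  *)
(* incoming edges: equality at an overpass, multiplication by s^(+-1) at a     *)
(* virtual crossing, and out = t in + (1 - t) over at an underpass.            *)
(* Eliminating all unknowns but those leaving the underpasses multiplies the   *)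
(* determinant of this system by 1 and leaves the matrix of zeta.  A move      *)
(* replaces a tangle by another one whose outgoing edges are the same          *)
(* combinations of the incoming edges, so that it preserves the determinant,   *)
(* up to a power of q for the first move; the third move is where the          *)
(* relations of T are needed.  A row of the system has degree at most 1 in s,  *)
(* and degree 1 only at the passages that cross a strand from left to right    *)
(* at a virtual crossing, one for each virtual crossing.                       *)
(* Without classical crossings the determinant is 0, so that no diagram of     *)
(* the class of D can lack them when zeta(D) is nonzero.                       *)

Set Implicit Arguments.
Unset Strict Implicit.
Unset Printing Implicit Defensive.

Import Order.TTheory GRing.Theory Num.Theory.
Local Open Scope ring_scope.

(** * Determinants indexed by lists of keys *)

(** Up to units of T, zeta is an invariant of the long virtual knot, and its degree in s never
    exceeds the number of virtual crossings. If [zeta D] reaches degree k, the number of virtual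
    crossings of D, its coefficient at s^k survives as a nonzero coefficient for every equivalent
    diagram, which therefore has at least k virtual crossings. Neither fact is visible on the matrix
    of zeta itself, so both are proved on a larger sparse system, whose determinant [word_det] makes
    sense for every well-formed word. Its unknowns sit on the edges of the curve closed up through
    infinity, and each passage contributes one local equation. The only tool is the Schur complement
    ([gdet_cat], [gdet_elim]), used in two ways. Eliminating the unknowns inside a tangle shows that
    the determinant sees a tangle only through its input-output relation ([wdet_replace]), so
    invariance ([word_det_move]) reduces to the computations [strand_omega1], [strand_omega2] and
    [strand_omega3]. Eliminating everything except the unknowns leaving underpasses gives the matrix
    of zeta ([eliminated], [zeta_entry], [zeta_wordE]): the power of s collected along a long arc is
    the degree of the arc. The degree bound ([deg_le_zeta_word], [count_virtual_l2r]) is read off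
    the rows of the sparse matrix. *)

Section KeyedDeterminant.
Variables (R : comNzRingType) (K : eqType) (x0 : K).
Implicit Types (s t ks : seq K) (F G : K -> K -> R).

Definition gdet ks F : R :=
  \det (\matrix_(i < size ks, j < size ks) F (nth x0 ks i) (nth x0 ks j)).

Lemma eq_gdet ks F G : {in ks &, F =2 G} -> gdet ks F = gdet ks G.
Proof.
by move=> eqFG; congr (\det _); apply/matrixP=> i j; rewrite !mxE eqFG ?mem_nth.
Qed.

(** The same permutation acts on rows and columns, so its sign occurs twice and cancels. Hence the
    keys may be listed in whatever order suits an elimination. *)
Lemma gdet_perm s t F : perm_eq s t -> gdet s F = gdet t F.
Proof.
move=> /[dup] /perm_size sz; rewrite -[t]/(tval (in_tuple t)) => /tuple_permP [p ->].
rewrite /gdet size_tuple.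
transitivity (\det (row_perm p (col_perm p
    (\matrix_(i < size t, j < size t) F (nth x0 t i) (nth x0 t j))))).
  congr (\det _); apply/matrixP=> i j; rewrite !mxE.
  by rewrite -!(tnth_nth x0) !tnth_mktuple !(tnth_nth x0).
rewrite row_permE col_permE !det_mulmx !det_perm odd_permV.
by rewrite mulrCA -expr2 sqrr_sign mulr1.
Qed.

Lemma gdet_trig ks F :
    pairwise (fun k j => F k j == 0) ks -> {in ks, forall k, F k k = 1} ->
  gdet ks F = 1.
Proof.
move=> /(pairwiseP x0) trig diag; rewrite /gdet det_trig.
  by rewrite big1 // => i _; rewrite mxE diag ?mem_nth.
by apply/is_trig_mxP => i j ltij; rewrite mxE; apply/eqP/trig; rewrite ?inE.
Qed.

Lemma gdet2 k j F : gdet [:: k; j] F = F k k * F j j - F k j * F j k.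
Proof.
rewrite /gdet /= (expand_det_row _ ord0) big_ord_recl big_ord1 /cofactor !det_mx11.
by rewrite !mxE /= expr0 expr1 mul1r mulN1r mulrN.
Qed.

(* Schur complement: [X] expresses the unknowns in [s] through those in [t]. *)
Lemma gdet_cat s t F (X : K -> K -> R) :
    {in s & t, forall k j, \sum_(m <- s) F k m * X m j + F k j = 0} ->
  gdet (s ++ t) F =
  gdet s F * gdet t (fun k j => \sum_(m <- s) F k m * X m j + F k j).
Proof.
move=> Xs; rewrite /gdet size_cat.
set M := (X in \det X = _).
set A := (X in \det X * _); set D := (X in _ * \det X).
pose C := \matrix_(i < size t, j < size s) F (nth x0 t i) (nth x0 s j).
pose Q := \matrix_(i < size s, j < size t) X (nth x0 s i) (nth x0 t j).
(* The unipotent factor adds to each column of [t] the combination [X] of the columns of [s]. By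
   hypothesis this clears the upper right block. *)
have -> : \det M = \det (M *m block_mx 1%:M Q 0 1%:M).
  by rewrite det_mulmx det_ublock !det1 !mulr1.
rewrite -(det_lblock _ C); congr (\det _); apply/matrixP=> i j; rewrite mxE.
have sumE (a : K) (b : K) :
    \sum_(l < size s) F a (nth x0 s l) * X (nth x0 s l) b
    = \sum_(m <- s) F a m * X m b.
  by rewrite (big_nth x0) big_mkord.
have nthl (l : 'I_(size s)) : nth x0 (s ++ t) (lshift (size t) l) = nth x0 s l.
  by rewrite nth_cat /= ltn_ord.
have nthr (l : 'I_(size t)) : nth x0 (s ++ t) (rshift (size s) l) = nth x0 t l.
  by rewrite nth_cat /= ltnNge leq_addr addKn.
have ME a b : M a b = F (nth x0 (s ++ t) a) (nth x0 (s ++ t) b) by rewrite mxE.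
rewrite big_split_ord /=.
case: (split_ordP j) => j' ->.
  rewrite [X in _ + X]big1 => [|l _]; last by rewrite block_mxEdl [X in _ * X]mxE mulr0.
  rewrite addr0 (bigD1 j') //= big1 => [|l nl]; last first.
    by rewrite block_mxEul [X in _ * X]mxE (negPf nl) mulr0.
  rewrite block_mxEul [X in _ * X]mxE eqxx mulr1 addr0 ME nthl.
  by case: (split_ordP i) => i' ->; rewrite ?block_mxEul ?block_mxEdl ?nthl ?nthr mxE.
rewrite [X in _ + X](bigD1 j') //= [X in _ + (_ + X)]big1 => [|l nl]; last first.
  by rewrite block_mxEdr [X in _ * X]mxE (negPf nl) mulr0.
rewrite block_mxEdr [X in _ * X + 0]mxE eqxx mulr1 addr0 ME nthr.
under eq_bigr => l _ do rewrite block_mxEur ME [X in _ * X]mxE nthl.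
rewrite sumE; case: (split_ordP i) => i' ->.
  by rewrite block_mxEur mxE nthl Xs ?mem_nth.
by rewrite block_mxEdr mxE nthr.
Qed.

End KeyedDeterminant.

Lemma gdet_map (R : comNzRingType) (K K' : eqType) (x0 : K) (f : K -> K')
    (ks : seq K) (F : K' -> K' -> R) :
  gdet (f x0) (map f ks) F = gdet x0 ks (fun k j => F (f k) (f j)).
Proof.
rewrite /gdet size_map; congr (\det _); apply/matrixP=> i j; rewrite !mxE.
by rewrite !(nth_map x0).
Qed.

(** * Elimination of unknowns from a sparse linear system *)

Section Elimination.
Variables (R : comNzRingType) (K : eqType) (x0 : K).
Variables (al be : K -> R) (mu : K -> K).
Implicit Types (s t ks : seq K) (p : K -> K) (val : K -> K -> R).

Definition unitv (k j : K) : R := (k == j)%:R.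

(** Row [k] of the system: the unknown of [k] equals [al k] times that of its predecessor [p k] plus
    [be k] times that of its mate [mu k]. *)
Definition bead p (k j : K) : R :=
  unitv k j - al k * unitv (p k) j - be k * unitv (mu k) j.

Definition reduced p val (k j : K) : R :=
  unitv k j - al k * val (p k) j - be k * val (mu k) j.

(** [val k j] is the coefficient of the unknown [j] in the expression of the unknown [k] once those
    of [s] are eliminated; an unknown outside [s] stands for itself. *)
Definition solves p val s : Prop :=
  [/\ {in s, forall k j, val k j = al k * val (p k) j + be k * val (mu k) j}
    & forall k, k \notin s -> val k =1 unitv k].

(** Substituting [val] is the column operation of [gdet_cat]. The determinant of the block of [s]
    stays as a factor because in the first move it is a unit other than 1. *)
Lemma gdet_elim s t p val :
    uniq (s ++ t) ->
    {in s ++ t, forall k, p k \in s ++ t} ->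
    {in s ++ t, forall k, be k = 0 \/ mu k \in s ++ t} ->
    solves p val s ->
  gdet x0 (s ++ t) (bead p) = gdet x0 s (bead p) * gdet x0 t (reduced p val).
Proof.
move=> Ust pst must [vals valt].
have [Us Dst] : uniq s /\ {in t, forall j, j \notin s}.
  by move: Ust; rewrite cat_uniq => /and3P [? /hasPn].
have sumE (a : K) (j : K) : a \in s ++ t -> j \in t ->
    \sum_(m <- s) unitv a m * val m j + unitv a j = val a j.
  move=> ast jt; case: (boolP (a \in s)) => as_.
    rewrite (bigD1_seq a) //= big1 => [|m]; last first.
      by rewrite eq_sym /unitv => /negPf ->; rewrite mul0r.
    rewrite /unitv eqxx mul1r addr0; case: eqP => [aj|_]; last by rewrite addr0.
    by move: (Dst _ jt); rewrite -aj as_.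
  rewrite big1_seq ?add0r ?valt // => m /andP [_ ms].
  by rewrite /unitv; case: eqP => [am|_]; [move: as_; rewrite am ms | rewrite mul0r].
have key (k j : K) : k \in s ++ t -> j \in t ->
    \sum_(m <- s) bead p k m * val m j + bead p k j
    = val k j - al k * val (p k) j - be k * val (mu k) j.
  move=> kst jt.
  have -> : \sum_(m <- s) bead p k m * val m j =
      \sum_(m <- s) unitv k m * val m j
      - al k * (\sum_(m <- s) unitv (p k) m * val m j)
      - be k * (\sum_(m <- s) unitv (mu k) m * val m j).
    rewrite !mulr_sumr -!sumrB; apply: eq_bigr => m _.
    by rewrite /bead !mulrBl !mulrA.
  rewrite -(sumE k j) // -(sumE (p k) j) ?pst //.
  have [b0|mk] := must _ kst; first by rewrite /bead b0; ring.
  by rewrite -(sumE (mu k) j) // /bead; ring.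
rewrite (@gdet_cat _ _ _ _ _ _ val) => [|k j ks jt]; last first.
  by rewrite key ?mem_cat ?ks // vals //; ring.
congr (_ * _); apply: eq_gdet => k j kt jt.
by rewrite key ?mem_cat ?kt ?orbT // valt ?Dst.
Qed.

Definition depends p (k j : K) : bool :=
  (p k == j) || (be k != 0) && (mu k == j).

(** An admissible order of elimination: each key of [s] is determined by earlier keys of [s] and by
    keys outside [s]. The block of [s] is then unitriangular, and the unknowns can be solved one
    after the other. *)
Definition acyclic p s : bool :=
  pairwise (fun k j => ~~ depends p k j) s && all (fun k => ~~ depends p k k) s.

Lemma acyclic_solvable s p : uniq s -> acyclic p s -> {val | solves p val s}.
Proof.
elim/last_ind: s => [|s k IHs]; first by exists unitv; split.
rewrite rcons_uniq => /andP [ks Us].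
rewrite /acyclic -cats1 pairwise_cat all_cat /= !andbT allrel1r.
move=> /andP [/andP [sk ps] /andP [dg dk]].
have /IHs [//|val [vals valt]] : acyclic p s by rewrite /acyclic ps.
pose val' m := if m == k then fun j => al k * val (p k) j + be k * val (mu k) j
               else val m.
exists val'; split=> [m|m].
  rewrite mem_cat inE => /orP ms j.
  have ndep : ~~ depends p m k by case: ms => [/(allP sk)|/eqP ->].
  have -> : val' (p m) = val (p m).
    by move: ndep; rewrite /depends /val' negb_or => /andP [/negPf ->].
  have -> : be m * val' (mu m) j = be m * val (mu m) j.
    move: ndep; rewrite /depends /val' negb_or => /andP [_].
    case: (be m =P 0) => [->|_] /=; first by rewrite !mul0r.
    by move=> /negPf ->.
  rewrite /val'; case: eqP => [-> //|/eqP mk].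
  by case: ms => [/vals ->//|]; rewrite (negPf mk).
rewrite mem_cat inE negb_or /val' => /andP [ms /negPf ->]; exact: valt.
Qed.

Lemma acyclic_gdet s p : uniq s -> acyclic p s -> gdet x0 s (bead p) = 1.
Proof.
move=> Us /andP [ps ds].
have unitN (k j : K) : k != j -> ~~ depends p k j -> bead p k j = 0.
  rewrite /depends /bead /unitv negb_or => /negPf -> /andP [/negPf -> nd].
  rewrite mulr0 subr0 sub0r; case: (be k =P 0) nd => [->|_] /=.
    by rewrite mul0r oppr0.
  by move=> /negPf ->; rewrite mulr0 oppr0.
apply: gdet_trig => [|k /(allP ds)].
  have := ps; rewrite uniq_pairwise in Us => ps'.
  have : pairwise [rel k j | (k != j) && ~~ depends p k j] s.
    by rewrite pairwise_relI Us.
  apply: sub_pairwise => k j /andP [kj nd]; apply/eqP; exact: unitN.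
rewrite /depends /bead /unitv eqxx negb_or => /andP [/negPf -> nd].
rewrite mulr0 subr0; case: (be k =P 0) nd => [->|_] /=; first by rewrite mul0r subr0.
by move=> /negPf ->; rewrite mulr0 subr0.
Qed.

Lemma acyclic_elim s t p :
    uniq (s ++ t) ->
    {in s ++ t, forall k, p k \in s ++ t} ->
    {in s ++ t, forall k, be k = 0 \/ mu k \in s ++ t} ->
    acyclic p s ->
  exists2 val, solves p val s &
    gdet x0 (s ++ t) (bead p) = gdet x0 t (reduced p val).
Proof.
move=> Ust pst must acy; have Us : uniq s by move: Ust; rewrite cat_uniq => /andP [].
have [val sol] := acyclic_solvable Us acy; exists val => //.
by rewrite (gdet_elim Ust pst must sol) acyclic_gdet // mul1r.
Qed.

End Elimination.

(** * Cyclic words *)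

Section Predecessor.
Variable K : eqType.
Implicit Types (a d k : K) (w : seq K).

(* The predecessor of [k] in the cyclic sequence [d :: w]; that of [d] is the *)
(* last element because [d] does not occur in [w].                            *)
Fixpoint prev_in d w k : K :=
  if w is x :: w' then if k == x then d else prev_in x w' k else d.

Lemma prev_in_cat d w1 w2 k : prev_in d (w1 ++ w2) k =
  if k \in w1 then prev_in d w1 k else prev_in (last d w1) w2 k.
Proof.
elim: w1 d => //= x w1 IH d; rewrite inE; case: eqP => //= _; exact: IH.
Qed.

Lemma prev_in_mem d w k : prev_in d w k \in d :: w.
Proof.
elim: w d => [|x w IH] d /=; first by rewrite mem_head.
by case: eqP => _; rewrite ?mem_head // inE IH orbT.
Qed.

Lemma prev_in_here d y z k : k \notin y -> prev_in d (y ++ k :: z) k = last d y.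
Proof. by rewrite prev_in_cat => /negPf -> /=; rewrite eqxx. Qed.

Lemma prev_in_neq d w k : uniq (d :: w) -> k \in w -> prev_in d w k != k.
Proof.
elim: w d => //= x w IH d; rewrite !inE !negb_or => /andP [/andP [dx _] Uw].
by case: (k =P x) => [-> //|_] /= kw; apply: IH.
Qed.

(** Predecessors come earlier, so the order of traversal is acyclic for keys that depend on nothing
    but their predecessor. *)
Lemma prev_in_pairwise d w : uniq (d :: w) ->
  pairwise (fun k j => prev_in d w k != j) w.
Proof.
elim: w d => //= x w IH d; rewrite inE negb_or => /andP [/andP [dx dw] /andP [xw Uw]].
rewrite eqxx; apply/andP; split.
  by apply/allP => j jw; apply: contraNneq dw => ->.
rewrite -(@eq_in_pairwise _ (mem w) (fun k j => prev_in x w k != j)).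
- by apply: IH; rewrite /= xw.
- by move=> k j kw _ /=; case: (k =P x) => // kx; rewrite -kx [_ \in w]kw in xw.
exact: allss.
Qed.

Lemma prev_in_skip a u z k : k \notin u -> prev_in a (u ++ z) k = prev_in (last a u) z k.
Proof. by rewrite prev_in_cat => /negPf ->. Qed.

Lemma prev_in_notin d k w : k \notin w -> prev_in d w k = last d w.
Proof. by move=> kw; rewrite -[w in LHS]cats0 prev_in_skip. Qed.

(** The closed curve has no preferred base point: it may be cut at [a] instead of [d]. *)
Lemma prev_in_rot d a k s1 s2 :
    uniq (d :: s1 ++ a :: s2) -> k \in s2 ++ d :: s1 ->
  prev_in d (s1 ++ a :: s2) k = prev_in a (s2 ++ d :: s1) k.
Proof.
rewrite /= mem_cat inE negb_or => /andP [/andP [d1 +]].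
rewrite negb_or => /andP [da d2].
rewrite cat_uniq /= negb_or => /and3P [_ /andP [a1 h21] /andP [a2 _]].
rewrite mem_cat inE !prev_in_cat /= => /or3P [k2|/eqP ->|k1].
- have k1 : k \notin s1 by move/hasPn: h21; exact.
  have ka : k != a by apply: contraNneq a2 => <-.
  by rewrite k2 (negPf k1) (negPf ka).
- by rewrite (negPf d1) (negPf da) (negPf d2) eqxx prev_in_notin.
have k2 : k \notin s2 by apply: contraL k1 => k2; move/hasPn: h21; exact.
have kd : k != d by apply: contraNneq d1 => <-.
by rewrite k1 (negPf k2) (negPf kd).
Qed.

End Predecessor.

(** * The determinant of a cyclic word and the replacement of tangles *)

Section WordDeterminant.
Variables (R : comNzRingType) (K : eqType) (d : K).
Variables (al be : K -> R) (mu : K -> K).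
Implicit Types (s t w : seq K) (val : K -> K -> R).

Definition wdet w : R := gdet d (d :: w) (bead al be mu (prev_in d w)).

Definition closed w : Prop := {in w, forall k, be k = 0 \/ mu k \in w}.

Hypothesis be_d : be d = 0.

Lemma wdet_elim s t w :
    uniq (d :: w) -> closed w -> perm_eq (d :: w) (s ++ t) ->
    acyclic be mu (prev_in d w) s ->
  exists2 val, solves al be mu (prev_in d w) val s &
    wdet w = gdet d t (reduced al be mu (prev_in d w) val).
Proof.
move=> Uw cw pw acy; rewrite /wdet (gdet_perm _ _ pw); apply: acyclic_elim => //.
- by rewrite -(perm_uniq pw).
- by move=> k _; rewrite -(perm_mem pw) prev_in_mem.
move=> k; rewrite -!(perm_mem pw) inE => /orP [/eqP ->|kw]; first by left.
by case: (cw k kw) => [|mk]; [left | right; rewrite inE mk orbT].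
Qed.

(** Locality. Eliminating the insides [s] and [s'] leaves two systems on the same outside keys [t].
    They coincide once every outside key receives the same input from its predecessor in both
    words. *)
Lemma wdet_replace s s' t w w' :
    uniq (d :: w) -> closed w -> perm_eq (d :: w) (s ++ t) ->
    acyclic be mu (prev_in d w) s ->
    uniq (d :: w') -> closed w' -> perm_eq (d :: w') (s' ++ t) ->
    acyclic be mu (prev_in d w') s' ->
    {in t, forall k, be k = 0 \/ mu k \in t} ->
    (forall val val', solves al be mu (prev_in d w) val s ->
       solves al be mu (prev_in d w') val' s' ->
       {in t, forall k, val (prev_in d w k) =1 val' (prev_in d w' k)}) ->
  wdet w = wdet w'.
Proof.
move=> Uw cw pw acy Uw' cw' pw' acy' ct vals.
have [val sol ->] := wdet_elim Uw cw pw acy.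
have [val' sol' ->] := wdet_elim Uw' cw' pw' acy'.
have notin r v : uniq (d :: v) -> perm_eq (d :: v) (r ++ t) -> {in t, forall k, k \notin r}.
  by move=> Uv pv; move: Uv; rewrite (perm_uniq pv) cat_uniq => /and3P [_ /hasPn].
apply: eq_gdet => k j kt jt; rewrite /reduced (vals _ _ sol sol') //.
case: (ct k kt) => [->|mt]; first by rewrite !mul0r.
by rewrite (proj2 sol _ (notin _ _ Uw pw _ mt)) (proj2 sol' _ (notin _ _ Uw' pw' _ mt)).
Qed.

(** Along a segment [u] shared by two words the predecessors are literally the same, except at its
    first key, where the entering values agree. Chaining this over the segments between the strands
    of a tangle compares two whole words. *)
Lemma prev_in_common val val' a a' u z z' k :
    {in u, forall x, val x =1 val' x} -> val a =1 val' a' ->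
    (val (last a u) =1 val' (last a' u) ->
     val (prev_in (last a u) z k) =1 val' (prev_in (last a' u) z' k)) ->
  val (prev_in a (u ++ z) k) =1 val' (prev_in a' (u ++ z') k).
Proof.
elim: u a a' => /= [|x u IH] a a' vu va goal; first exact: goal.
case: eqP => // _; apply: IH => //.
  by move=> y yu; apply: vu; rewrite inE yu orbT.
by apply: vu; rewrite mem_head.
Qed.

End WordDeterminant.

(** * Coefficients of a crossing *)

Section Coefficients.
Variables (R : comNzRingType) (t_mono : bool -> bool -> R) (s_mono : bool -> R).
Hypothesis t_mono_inv : forall e g, t_mono e g * t_mono e (~~ g) = 1.
Hypothesis t_mono_rel : forall e1 e2 e3 g g3, (1 - t_mono e3 g3) * (t_mono e1 g - t_mono e2 g) = 0.
Hypothesis s_mono_inv : forall g, s_mono g * s_mono (~~ g) = 1.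

(* [e]: the crossing is an early overcrossing; [g]: [l2r] of the passage.  The *)
(* writhe is positive iff the overpass, whose [l2r] is [~~ g] if the passage   *)
(* is an underpass, crosses from left to right; [t_mono e true] stands for t   *)
(* and [t_mono e false] for its inverse.                                       *)
Definition coef (l : level) (e g : bool) : R :=
  match l with Over => 1 | Under => t_mono e (~~ g) | Virtual => s_mono g end.

Definition cross (l : level) (e g : bool) : R :=
  if l is Under then 1 - coef l e g else 0.

(** This lemma and the next solve the relation of T for a product, so that [ring:] can use it as a
    reduction rule; they treat equal and opposite exponents at the crossings 1 and 2. *)
Lemma t_mono_rel_same e1 e2 e3 g g3 :
  t_mono e3 g3 * t_mono e1 g = t_mono e1 g - t_mono e2 g + t_mono e3 g3 * t_mono e2 g.
Proof.
apply/eqP; rewrite -subr_eq0 -[X in _ == X]oppr0 -(t_mono_rel e1 e2 e3 g g3); apply/eqP; ring.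
Qed.

Lemma t_mono_rel_opp e1 e2 e3 g g3 :
  t_mono e3 g3 * (t_mono e1 g * t_mono e2 (~~ g)) =
  t_mono e1 g * t_mono e2 (~~ g) - 1 + t_mono e3 g3.
Proof.
have rel := t_mono_rel e1 e2 e3 g g3; have inv := t_mono_inv e2 g.
have : t_mono e2 (~~ g) * ((1 - t_mono e3 g3) * (t_mono e1 g - t_mono e2 g)) = 0.
  by rewrite rel mulr0.
move=> h; apply/eqP; rewrite -subr_eq0 -[X in _ == X]oppr0 -h; apply/eqP.
ring: inv.
Qed.

(** The equations along a strand that enters with value [a] and makes two passages: [x] and [y] are
    the values leaving them, [mx] and [my] the values leaving their mates, and [o] tells whether the
    passage of [x] comes first. *)
Definition strand (o : bool) (l1 l2 : level) (e1 e2 g1 g2 : bool) (a x y mx my : R) : Prop :=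
  if o then x = coef l1 e1 g1 * a + cross l1 e1 g1 * mx /\
            y = coef l2 e2 g2 * x + cross l2 e2 g2 * my
  else y = coef l2 e2 g2 * a + cross l2 e2 g2 * my /\
       x = coef l1 e1 g1 * y + cross l1 e1 g1 * mx.

(** Equal [e] and opposite [g] make the coefficients of the two crossings inverse to each other, so
    the second crossing undoes the first. *)
Lemma strand_omega2 (o : bool) (l : level) (e g : bool) (a b X Y MX MY : R) :
    strand true l l e e g (~~ g) a X Y MX MY ->
    strand o (opp_level l) (opp_level l) e e (~~ g) g b MX MY X Y ->
  Y = a /\ (if o then MY else MX) = b.
Proof.
case: l o g => [] [] [] /=; rewrite ?mul0r ?addr0 ?mul1r.
all: move=> [h1 h2] [h3 h4]; subst; split.
all: try by [].
all: try by ring: (s_mono_inv true).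
all: by ring: (t_mono_inv e true).
Qed.

(** The two coefficients at an underpass add up to 1, so a classical kink carries a constant value.
    In a virtual kink the loop gains a power of s, which is lost on leaving it. *)
Lemma strand_omega1 (l : level) (e g : bool) (a : R) :
  ((if l is Virtual then s_mono g else 1) * a =
  coef l e g * a + cross l e g * a) /\
  (a = coef (opp_level l) e (~~ g) * ((if l is Virtual then s_mono g else 1) * a) +
       cross (opp_level l) e (~~ g) * ((if l is Virtual then s_mono g else 1) * a)).
Proof.
by case: l => /=; split; rewrite ?mul0r; try ring; case: g; ring: (s_mono_inv true).
Qed.

Ltac t_mono_ring e1 e2 e3 := first [
   ring: (t_mono_rel_same e1 e2 e3 true true) | ring: (t_mono_rel_same e1 e2 e3 true false)
 | ring: (t_mono_rel_same e1 e2 e3 false true) | ring: (t_mono_rel_same e1 e2 e3 false false)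
 | ring: (t_mono_rel_opp e1 e2 e3 true true) | ring: (t_mono_rel_opp e1 e2 e3 true false)
 | ring: (t_mono_rel_opp e1 e2 e3 false true) | ring: (t_mono_rel_opp e1 e2 e3 false false)].

(** For each admissible triangle and choice of levels, both triples of outgoing values are explicit
    combinations of [a], [b], [c]. The relation of T enters because t may be p at some of three
    classical crossings and q at others. *)
Lemma strand_omega3 (o1 o2 o3 : bool) (u v x : passage) (eu ev ex : bool)
    (a b c U V MU X MV MX U' V' MU' X' MV' MX' : R) :
    triangle o1 o2 o3 u v x -> third_move_levels u v x ->
    strand o1 (lev u) (lev v) eu ev (l2r u) (l2r v) a U V MU MV ->
    strand o2 (lev (mate u)) (lev x) eu ex (l2r (mate u)) (l2r x) b MU X U MX ->
    strand o3 (lev (mate v)) (lev (mate x)) ev ex (l2r (mate v)) (l2r (mate x))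
      c MV MX V X ->
    strand (~~ o1) (lev u) (lev v) eu ev (l2r u) (l2r v) a U' V' MU' MV' ->
    strand (~~ o2) (lev (mate u)) (lev x) eu ex (l2r (mate u)) (l2r x) b MU' X' U' MX' ->
    strand (~~ o3) (lev (mate v)) (lev (mate x)) ev ex (l2r (mate v)) (l2r (mate x))
      c MV' MX' V' X' ->
  [/\ (if o1 then V else U) = (if o1 then U' else V'),
      (if o2 then X else MU) = (if o2 then MU' else X') &
      (if o3 then MX else MV) = (if o3 then MV' else MX')].
Proof.
case: u v x => nu lu gu [nv lv gv] [nx lx gx].
rewrite /triangle /on_left /third_move_levels /= => tri lvl.
move: o1 o2 o3 gu gv gx tri => [] [] [] [] [] [] // _.
all: move: lu lv lx lvl => [] [] [] // _; rewrite /= ?mul0r ?addr0 ?mul1r.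
all: repeat (let e1 := fresh in let e2 := fresh in move=> [e1 e2]); subst; split.
all: try by [].
all: try by ring.
all: try by ring: (s_mono_inv true).
(* Which two of the three crossings the relation must compare depends on the case, so each choice is
   tried. *)
all: first [t_mono_ring eu ev ex | t_mono_ring eu ex ev | t_mono_ring ev ex eu].
Qed.

End Coefficients.

(** * Invariance under the moves *)

Definition passage_code (x : passage) := (label x, lev x, l2r x).
Definition passage_decode (c : nat * level * bool) := Passage c.1.1 c.1.2 c.2.
Lemma passage_codeK : cancel passage_code passage_decode. Proof. by case. Qed.
HB.instance Definition _ := Equality.copy passage (can_type passage_codeK).

Lemma mateK : involutive mate.
Proof. by case=> n l g; rewrite /mate /= negbK; case: l. Qed.

Lemma mate_neq x : mate x != x.
Proof. by apply/eqP => /(congr1 l2r) /=; case: (l2r x). Qed.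

Lemma all_neq (K : eqType) (a : K) s : all (fun j => a != j) s = (a \notin s).
Proof. by elim: s => //= x s ->; rewrite inE negb_or. Qed.

Lemma acyclic_cons (R : comNzRingType) (K : eqType) (be : K -> R) mu p k s :
  acyclic be mu p (k :: s) =
  [&& p k \notin k :: s, (be k == 0) || (mu k \notin k :: s) & acyclic be mu p s].
Proof.
have dep j : ~~ depends be mu p k j = (p k != j) && ((be k == 0) || (mu k != j)).
  by rewrite /depends negb_or negb_and negbK.
have all_dep s' : all (fun j => ~~ depends be mu p k j) s' =
    (p k \notin s') && ((be k == 0) || (mu k \notin s')).
  rewrite (eq_all dep) all_predI all_neq; congr (_ && _).
  by case: (be k == 0) => /=; rewrite ?all_predT ?all_neq.
rewrite [RHS]andbA -(all_dep (k :: s)) /acyclic /=.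
by rewrite -!andbA; do !bool_congr.
Qed.

Lemma uniq_last (K : eqType) (d : K) w z : uniq (d :: w ++ z) -> uniq (last d w :: z).
Proof.
by rewrite -cat_cons lastI cat_rcons cat_uniq => /and3P [].
Qed.

Ltac split_ands := repeat match goal with
  H : is_true (_ && _) |- _ =>
    let H1 := fresh H in let H2 := fresh H in case/andP: H => [H1 H2] end.

Ltac distinct := rewrite ?inE ?negb_or; 
  repeat first [apply/andP; split | apply/orP; right];
  first [done | assumption | rewrite eq_sym; assumption].

(* The keys [inr n] are trivial beads: [inr 0] stands for the point at       *)
(* infinity, and the others separate adjacent segments of a tangle, which    *)
(* would otherwise feed into one another and make the elimination cyclic.    *)
Local Notation key := (passage + nat)%type.
Local Notation keys := (map (inl : passage -> key)).

(** * The determinant of a word of passages; the first two moves *)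

Section Beads.
Variables (R : comNzRingType) (t_mono : bool -> bool -> R) (s_mono : bool -> R).
Hypothesis t_mono_inv : forall e g, t_mono e g * t_mono e (~~ g) = 1.
Hypothesis t_mono_rel : forall e1 e2 e3 g g3, (1 - t_mono e3 g3) * (t_mono e1 g - t_mono e2 g) = 0.
Hypothesis s_mono_inv : forall g, s_mono g * s_mono (~~ g) = 1.

Implicit Types (E : nat -> bool) (w : seq key) (x y : passage).

Definition key_coef E (k : key) : R :=
  if k is inl x then coef t_mono s_mono (lev x) (E (label x)) (l2r x) else 1.

Definition key_cross E (k : key) : R :=
  if k is inl x then cross t_mono s_mono (lev x) (E (label x)) (l2r x) else 0.

Definition key_mate (k : key) : key := if k is inl x then inl (mate x) else k.

Definition infinity : key := inr 0.

Definition bead_det E w : R := wdet infinity (key_coef E) (key_cross E) key_mate w.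

Definition matched_keys w : Prop :=
  {in w, forall k, if k is inl x then inl (mate x) \in w else true}.

Lemma matched_closed E w : matched_keys w -> closed (key_cross E) key_mate w.
Proof. by move=> mw k kw; have := mw _ kw; case: k kw => [x|n] _ /=; [right | left]. Qed.

Lemma matched_cons E w : matched_keys w ->
  {in infinity :: w, forall k, key_cross E k = 0 \/ key_mate k \in infinity :: w}.
Proof.
move=> mw k; rewrite inE => /orP [/eqP ->|kw]; first by left.
by have [|h] := matched_closed E mw kw; [left | right; rewrite inE h orbT].
Qed.

Lemma prev_inE w w1 w2 k : w = w1 ++ k :: w2 -> uniq (infinity :: w) ->
  prev_in infinity w k = last infinity w1.
Proof.
move=> ->; rewrite cons_uniq => /andP [_]; rewrite cat_uniq => /and3P [_ /hasPn h _].
by rewrite prev_in_here //; apply: h; rewrite mem_head.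
Qed.

(** A trivial bead passes its input on unchanged, so it can be eliminated or inserted at will. *)
Lemma bead_det_separator E w1 w2 n :
    uniq (infinity :: w1 ++ inr n :: w2) -> matched_keys (w1 ++ w2) ->
  bead_det E (w1 ++ inr n :: w2) = bead_det E (w1 ++ w2).
Proof.
move=> Uw mw.
have pw : perm_eq (infinity :: w1 ++ inr n :: w2) ([:: inr n] ++ infinity :: w1 ++ w2).
  by apply/seq.permP => P; rewrite /= !count_cat /=; ring.
have Uw' : uniq (infinity :: w1 ++ w2).
  by move: Uw; rewrite (perm_uniq pw) => /andP [].
have mw' : matched_keys (w1 ++ inr n :: w2).
  move=> [x|//]; have := mw (inl x).
  by rewrite !mem_cat !inE /=.
have px := prev_inE (erefl _) Uw.
have lx : last infinity w1 != inr n.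
  by move: (uniq_last Uw) => /= /andP [+ _]; rewrite inE negb_or => /andP [].
apply: (wdet_replace _ (s := [:: inr n]) (s' := [::]) (t := infinity :: w1 ++ w2)) => //.
- exact: matched_closed.
- by rewrite acyclic_cons px /= inE lx eqxx.
- exact: matched_closed.
- exact: matched_cons.
move=> val val' [vals valt] [_ valt'] k kt.
have kn : k != inr n.
  by apply: contraTneq kt => ->; move: Uw; rewrite (perm_uniq pw) => /andP [].
have val_in : {in infinity :: w1 ++ w2, forall m, val m =1 val' m}.
  move=> m mt j; rewrite valt' // valt // inE.
  by apply: contraTneq mt => ->; move: Uw; rewrite (perm_uniq pw) => /andP [].
apply: prev_in_common => [m mw1||last_eq]; try by apply: val_in; rewrite inE ?mem_cat ?mw1 ?orbT.
rewrite /= (negPf kn); move: (last_eq) => _.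
rewrite -[w2]cats0; apply: prev_in_common => //.
  by move=> m mw2; apply: val_in; rewrite inE mem_cat mw2 !orbT.
by move=> j; rewrite vals ?mem_head //= px mul1r mul0r addr0 last_eq.
Qed.

(** If [x] is the underpass, the two keys of the kink depend on each other and no order is acyclic.
    The solution is therefore exhibited, and the block contributes its determinant 1 - (1 - t) = t;
    in the other cases the block has determinant 1. *)
Lemma bead_det_omega1 E x w1 w2 :
    uniq (infinity :: w1 ++ [:: inl x, inl (mate x) & w2]) -> matched_keys (w1 ++ w2) ->
  bead_det E (w1 ++ [:: inl x, inl (mate x) & w2]) =
  (if lev x is Under then t_mono (E (label x)) (~~ l2r x) else 1) * bead_det E (w1 ++ w2).
Proof.
set X : key := inl x; set M : key := inl (mate x) => Uw mw.
set w := w1 ++ [:: X, M & w2] in Uw *; set t := infinity :: w1 ++ w2.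
have pw : perm_eq (infinity :: w) ([:: X; M] ++ t).
  by apply/seq.permP => P; rewrite /= !count_cat /=; ring.
have Ust : uniq ([:: X; M] ++ t) by rewrite -(perm_uniq pw).
have pX : prev_in infinity w X = last infinity w1 by exact: (prev_inE (erefl _) Uw).
have pM : prev_in infinity w M = X.
  by rewrite (@prev_inE _ (w1 ++ [:: X]) w2) // -?catA // last_cat.
have a_t : last infinity w1 \in t by rewrite /t -cat_cons mem_cat mem_last.
have tXM k : k \in t -> (k != X) /\ (k != M).
  move=> kt; move: Ust; rewrite cat_uniq => /and3P [_ /hasPn/(_ _ kt) + _].
  by rewrite !inE negb_or => /andP.
have MX : M != X by exact: mate_neq.
pose c : R := if lev x is Virtual then s_mono (l2r x) else 1.
pose a := unitv R (last infinity w1).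
(* [X] leads into the loop, where the input is multiplied by [c]; [M] leaves the kink with the input
   restored. *)
pose val k j := if k == X then c * a j else if k == M then a j else unitv R k j.
have val_t : {in t, forall k, val k =1 unitv R k}.
  by move=> k /tXM [/negPf kX /negPf kM] j; rewrite /val kX kM.
have sol : solves (key_coef E) (key_cross E) key_mate (prev_in infinity w) val [:: X; M].
  split=> k; last by rewrite !inE negb_or /val => /andP [/negPf -> /negPf ->].
  rewrite !inE => kXM j.
  have [alg1 alg2] := strand_omega1 t_mono s_mono_inv (lev x) (E (label x)) (l2r x) (a j).
  case/orP: kXM => /eqP ->.
    rewrite pX (val_t _ a_t) /val /= !eqxx (negPf MX); exact: alg1.
  rewrite pM /val /= !eqxx (negPf MX) mateK eqxx; exact: alg2.
rewrite /bead_det /wdet (gdet_perm _ _ pw) (gdet_elim _ _ _ _ sol) //; last 2 first.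
- by move=> k _; rewrite -(perm_mem pw) prev_in_mem.
- move=> k; rewrite mem_cat => /orP []; last first.
    by move=> /(matched_cons E mw) [|h]; [left | right; rewrite mem_cat h orbT].
  by rewrite !inE => /orP [] /eqP ->; right; rewrite /= ?mateK eqxx ?orbT.
congr (_ * _).
  rewrite gdet2 /bead /unitv pX pM /= mateK !eqxx (negPf MX) [X == M]eq_sym (negPf MX).
  have [/negPf -> /negPf ->] := tXM _ a_t.
  by case: (lev x) => /=; ring.
apply: eq_gdet => k j kt _; rewrite /reduced /bead.
have -> : val (prev_in infinity w k) j = unitv R (prev_in infinity (w1 ++ w2) k) j.
  have [/negPf kX /negPf kM] := tXM k kt.
  apply: prev_in_common => [m mw1||last_eq]; try by apply: val_t; rewrite inE ?mem_cat ?mw1 ?orbT.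
  rewrite /= kX kM -[w2]cats0; apply: prev_in_common => //.
    by move=> m mw2; apply: val_t; rewrite inE mem_cat mw2 !orbT.
  by move=> j'; rewrite /val (negPf MX) eqxx.
by case: (matched_cons E mw kt) => [->|/val_t ->]; rewrite ?mul0r.
Qed.

(** [f] and [g] are the passages of the second strand in its own order, parallel or antiparallel to
    the first. The separator keeps the second strand from taking its input directly from [y] when
    [w2] is empty. *)
Lemma bead_det_omega2 E x y f g n w1 w2 w3 :
    lev x = lev y -> l2r y = ~~ l2r x -> E (label x) = E (label y) ->
    [:: f; g] = [:: mate x; mate y] \/ [:: f; g] = [:: mate y; mate x] ->
    uniq (infinity :: w1 ++ [:: inl x, inl y & w2 ++ [:: inr n, inl f, inl g & w3]]) ->
    matched_keys (w1 ++ w2 ++ w3) ->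
  bead_det E (w1 ++ [:: inl x, inl y & w2 ++ [:: inr n, inl f, inl g & w3]]) =
  bead_det E (w1 ++ w2 ++ inr n :: w3).
Proof.
move=> lxy gxy Exy fg Uw mw.
set X : key := inl x in Uw *; set Y : key := inl y in Uw *.
set F : key := inl f in Uw *; set G : key := inl g in Uw *.
set e : key := inr n in Uw *.
set w := w1 ++ _ in Uw *; set w' := w1 ++ w2 ++ _.
set t := infinity :: w'; pose a := last infinity w1.
(* The overstrand is solved first: it does not depend on the other strand, whereas an underpass uses
   the value of its overpass. *)
pose s := if lev x is Under then [:: F; G; X; Y] else [:: X; Y; F; G].
have ps : perm_eq s [:: X; Y; F; G].
  by rewrite /s; case: (lev x) => //; rewrite (perm_catC [:: F; G] [:: X; Y]).
have pw0 : perm_eq (infinity :: w) ([:: X; Y; F; G] ++ t).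
  by apply/seq.permP => P; rewrite /= !count_cat /= !count_cat /=; ring.
have pw : perm_eq (infinity :: w) (s ++ t).
  by rewrite (perm_trans pw0) // perm_sym perm_cat2r.
have Ust : uniq ([:: X; Y; F; G] ++ t) by rewrite -(perm_uniq pw0).
have t_notin k : k \in t -> k \notin [:: X; Y; F; G].
  by move=> kt; move: Ust; rewrite cat_uniq => /and3P [_ /hasPn/(_ _ kt)].
have a_t : a \in t by rewrite /t -cat_cons mem_cat mem_last.
have e_t : e \in t by rewrite inE !mem_cat !inE eqxx ?orbT.
have [Us Ut] : uniq [:: X; Y; F; G] /\ uniq t by move: Ust; rewrite cat_uniq => /and3P [].
have pX : prev_in infinity w X = a by exact: (prev_inE (erefl _) Uw).
have pY : prev_in infinity w Y = X.
  by rewrite (@prev_inE _ (w1 ++ [:: X]) (w2 ++ [:: e, F, G & w3]) _ _ Uw) ?last_cat //= -catA.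
have pF : prev_in infinity w F = e.
  rewrite (@prev_inE _ (w1 ++ [:: X, Y & w2 ++ [:: e]]) (G :: w3) _ _ Uw) /=.
    by rewrite last_cat /= last_cat.
  by rewrite /w -catA /= -catA.
have pG : prev_in infinity w G = F.
  rewrite (@prev_inE _ (w1 ++ [:: X, Y & w2 ++ [:: e; F]]) w3 _ _ Uw) /=.
    by rewrite last_cat /= last_cat.
  by rewrite /w -catA /= -catA.
have mw' : matched_keys w'.
  move=> [z|//]; have := mw (inl z).
  by rewrite !mem_cat !inE /=.
have mww : matched_keys w.
  have wE k : k \in w = (k \in [:: X; Y; F; G]) || (k \in w').
    by rewrite !(mem_cat, inE); do !bool_congr.
  move=> [z|//]; rewrite !wE => /orP [zs|/mw' ->]; last by rewrite orbT.
  have sE : [:: X; Y; F; G] =i [:: inl x; inl y; inl (mate x); inl (mate y)].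
    by move=> k; rewrite /F /G; case: fg => -[-> ->]; rewrite !inE; do !bool_congr.
  by move: zs; rewrite !sE !inE => /or4P [] /eqP [->]; rewrite ?mateK eqxx ?orbT.
apply: (wdet_replace _ (s := s) (s' := [::]) (t := t)) => //.
- exact: matched_closed.
- have := t_notin _ e_t; have := t_notin _ a_t; have := Us.
  rewrite !cons_uniq !inE !negb_or => Us' as_ es; split_ands.
  have lfg : lev f = opp_level (lev x) /\ lev g = opp_level (lev x).
    by case: fg => -[-> ->] /=; rewrite -lxy.
  have mfg : (mate f = x /\ mate g = y) \/ (mate f = y /\ mate g = x).
    by case: fg => -[-> ->]; rewrite !mateK; [left | right].
  have {fg} mfg' : (mate x = f /\ mate y = g) \/ (mate x = g /\ mate y = f).
    by case: fg => -[-> ->]; [left | right].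
  rewrite /s; case lx: (lev x); rewrite !acyclic_cons pX pY pF pG /=;
    rewrite -?lxy lx ?(proj1 lfg) ?(proj2 lfg) lx /= ?eqxx /=;
    case: mfg mfg' => -[mf mg] [] [mx my];
    rewrite ?mf ?mg ?mx ?my; distinct.
- exact: matched_closed.
- exact: matched_cons.
move=> val val' [vals valt] [_ valt'] k kt.
have t_s m : m \in t -> m \notin s by rewrite (perm_mem ps); exact: t_notin.
have val_t : {in t, forall m, val m =1 val' m}.
  by move=> m /t_s ms j; rewrite valt' // valt.
have strands j : val Y j = val' a j /\ val G j = val' e j.
  have sol m : m \in [:: X; Y; F; G] -> val m j =
      key_coef E m * val (prev_in infinity w m) j + key_cross E m * val (key_mate m) j.
    by rewrite -(perm_mem ps) => /vals ->.
  have := sol X; have := sol Y; have := sol F; have := sol G.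
  rewrite !inE !eqxx ?orbT => /(_ isT) hG /(_ isT) hF /(_ isT) hY /(_ isT) hX.
  rewrite -(val_t _ a_t) -(val_t _ e_t).
  rewrite pX pY pF pG /= -?lxy -?Exy ?gxy in hX hY hF hG.
  case: fg => -[ef eg]; rewrite -?ef -?eg in hX hY.
    rewrite ef eg /= !mateK -?lxy -?Exy ?gxy ?negbK in hF hG.
    by have [] := @strand_omega2 _ _ _ t_mono_inv s_mono_inv true _ _ _ _ _ _ _ _ _
      (conj hX hY) (conj hF hG).
  rewrite ef eg /= !mateK -?lxy -?Exy ?gxy ?negbK in hF hG.
  by have [] := @strand_omega2 _ _ _ t_mono_inv s_mono_inv false _ _ _ _ _ _ _ _ _
    (conj hX hY) (conj hF hG).
have := t_notin _ kt; rewrite !inE !negb_or => /and4P [/negPf kX /negPf kY /negPf kF /negPf kG].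
apply: prev_in_common => [m mw1||_]; try by apply: val_t; rewrite inE ?mem_cat ?mw1 ?orbT.
rewrite /= kX kY; apply: prev_in_common => [m mw2|j|last_eq].
- by apply: val_t; rewrite inE !mem_cat mw2 !orbT.
- by have [-> _] := strands j.
rewrite /= -/e; case: (k =P e) => // _.
rewrite /= kF kG -[w3]cats0; apply: prev_in_common => [m mw3|j|//].
- by apply: val_t; rewrite inE !mem_cat inE mw3 !orbT.
- by have [_ ->] := strands j.
Qed.

Definition first_of (o : bool) (y z : passage) : key := inl (if o then y else z).
Definition second_of (o : bool) (y z : passage) : key := inl (if o then z else y).

(** Segments are listed from top to bottom, since an underpass uses the value above it, while
    virtual crossings impose no order. Cyclic heights, for which no such list exists, are ruled out
    by [third_move_levels]. *)
Definition tangle_order (u v x : passage) (s1 s2 s3 : seq key) : seq key :=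
  match lev u, lev v, lev x with
  | Under, Under, Under => s3 ++ s2 ++ s1
  | Under, Under, _ => s2 ++ s3 ++ s1
  | Under, _, _ => s2 ++ s1 ++ s3
  | _, Under, _ => s3 ++ s1 ++ s2
  | _, _, Under => s1 ++ s3 ++ s2
  | _, _, _ => s1 ++ s2 ++ s3
  end.

Lemma perm_tangle_order u v x s1 s2 s3 :
  perm_eq (tangle_order u v x s1 s2 s3) (s1 ++ s2 ++ s3).
Proof.
rewrite /tangle_order; apply/seq.permP => P.
by case: (lev u) (lev v) (lev x) => [] [] []; rewrite !count_cat; ring.
Qed.

Lemma acyclic_tangle E p o1 o2 o3 u v x a b c :
    third_move_levels u v x ->
    uniq [:: inl u; inl v; inl (mate u); inl x; inl (mate v); inl (mate x) : key] ->
    {in [:: a; b; c], forall k : key, k \notin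
      [:: inl u; inl v; inl (mate u); inl x; inl (mate v); inl (mate x)]} ->
    [/\ p (first_of o1 u v) = a, p (first_of o2 (mate u) x) = b
      & p (first_of o3 (mate v) (mate x)) = c] ->
    [/\ p (second_of o1 u v) = first_of o1 u v,
        p (second_of o2 (mate u) x) = first_of o2 (mate u) x
      & p (second_of o3 (mate v) (mate x)) = first_of o3 (mate v) (mate x)] ->
  acyclic (key_cross E) key_mate p (tangle_order u v x
    [:: first_of o1 u v; second_of o1 u v]
    [:: first_of o2 (mate u) x; second_of o2 (mate u) x]
    [:: first_of o3 (mate v) (mate x); second_of o3 (mate v) (mate x)]).
Proof.
rewrite /third_move_levels /tangle_order => lvl Us abc.
have ha := abc a; have hb := abc b; have hc := abc c => -[pa pb pc] [p1 p2 p3].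
rewrite !cons_uniq !inE !negb_or ?eqxx ?orbT /= in Us ha hb hc.
move: (ha isT) (hb isT) (hc isT) => {}ha {}hb {}hc; split_ands.
case lu: (lev u) lvl; case lv: (lev v); case lx: (lev x); rewrite /= ?lu ?lv ?lx //= => _.
all: rewrite !acyclic_cons ?pa ?pb ?pc ?p1 ?p2 ?p3 {pa pb pc p1 p2 p3}.
all: rewrite /first_of /second_of; case: o1; case: o2; case: o3.
all: rewrite /= ?lu ?lv ?lx /= ?eqxx ?mateK /=.
all: distinct.
Qed.

End Beads.

(** * The third move *)

Section ThreeStrands.
Variables (R : comNzRingType) (t_mono : bool -> bool -> R) (s_mono : bool -> R).
Hypothesis t_mono_inv : forall e g, t_mono e g * t_mono e (~~ g) = 1.
Hypothesis t_mono_rel : forall e1 e2 e3 g g3, (1 - t_mono e3 g3) * (t_mono e1 g - t_mono e2 g) = 0.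
Hypothesis s_mono_inv : forall g, s_mono g * s_mono (~~ g) = 1.
Implicit Types (E : nat -> bool) (w : seq key).

Section Word.
Variables (e1 e2 : key) (w1 w2 w3 w4 : seq key).

Definition three_strands (f1 g1 f2 g2 f3 g3 : key) : seq key :=
  w1 ++ [:: f1, g1 & w2 ++ [:: e1, f2, g2 & w3 ++ [:: e2, f3, g3 & w4]]].

Definition outside : seq key := infinity :: w1 ++ w2 ++ e1 :: w3 ++ e2 :: w4.

Lemma perm_three_strands f1 g1 f2 g2 f3 g3 :
  perm_eq (infinity :: three_strands f1 g1 f2 g2 f3 g3)
          ([:: f1; g1; f2; g2; f3; g3] ++ outside).
Proof.
by apply/seq.permP => P; rewrite /= !count_cat /= !count_cat /= !count_cat /=; ring.
Qed.

Lemma prev_three_strands f1 g1 f2 g2 f3 g3 (w := three_strands f1 g1 f2 g2 f3 g3) :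
  uniq (infinity :: w) ->
  [/\ prev_in infinity w f1 = last infinity w1, prev_in infinity w f2 = e1
    & prev_in infinity w f3 = e2] /\
  [/\ prev_in infinity w g1 = f1, prev_in infinity w g2 = f2
    & prev_in infinity w g3 = f3].
Proof.
move=> Uw; split; split.
- exact: (prev_inE (erefl _) Uw).
- rewrite (@prev_inE _ (w1 ++ [:: f1, g1 & w2 ++ [:: e1]])
    (g2 :: w3 ++ [:: e2, f3, g3 & w4]) _ _ Uw).
    by rewrite !(last_cat, last_cons).
  by rewrite -catA /= -catA.
- rewrite (@prev_inE _ (w1 ++ [:: f1, g1 & w2 ++ [:: e1, f2, g2 & w3 ++ [:: e2]]]) (g3 :: w4) _ _ Uw).
    by rewrite !(last_cat, last_cons).
  by rewrite -catA /= -catA /= -catA.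
- rewrite (@prev_inE _ (w1 ++ [:: f1])
    (w2 ++ [:: e1, f2, g2 & w3 ++ [:: e2, f3, g3 & w4]]) _ _ Uw).
    by rewrite !(last_cat, last_cons).
  by rewrite -catA.
- rewrite (@prev_inE _ (w1 ++ [:: f1, g1 & w2 ++ [:: e1; f2]]) (w3 ++ [:: e2, f3, g3 & w4]) _ _ Uw).
    by rewrite !(last_cat, last_cons).
  by rewrite -catA /= -catA.
rewrite (@prev_inE _ (w1 ++ [:: f1, g1 & w2 ++ [:: e1, f2, g2 & w3 ++ [:: e2; f3]]]) w4 _ _ Uw).
  by rewrite !(last_cat, last_cons).
by rewrite -catA /= -catA /= -catA.
Qed.

(** Outside keys see the tangle only through the last passages [g1], [g2], [g3] of its strands. *)
Lemma walk_three_strands f1 g1 f2 g2 f3 g3 f1' g1' f2' g2' f3' g3' (val val' : key -> key -> R) k :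
    {in outside, forall m, val m =1 val' m} ->
    [/\ val g1 =1 val' g1', val g2 =1 val' g2' & val g3 =1 val' g3'] ->
    k \notin [:: f1; g1; f2; g2; f3; g3] -> k \notin [:: f1'; g1'; f2'; g2'; f3'; g3'] ->
  val (prev_in infinity (three_strands f1 g1 f2 g2 f3 g3) k) =1
  val' (prev_in infinity (three_strands f1' g1' f2' g2' f3' g3') k).
Proof.
move=> val_t [eq1 eq2 eq3]; rewrite !inE !negb_or.
do 5!(case/andP=> /negPf ?); move/negPf=> ?; do 5!(case/andP=> /negPf ?); move/negPf=> ?.
have vt m u : {subset u <= outside} -> m \in u -> val m =1 val' m.
  by move=> su /su; exact: val_t.
have s1 : {subset w1 <= outside} by move=> m mw; rewrite inE !mem_cat mw ?orbT.
have s2 : {subset w2 <= outside} by move=> m mw; rewrite inE !mem_cat mw ?orbT.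
have s3 : {subset w3 <= outside} by move=> m mw; rewrite inE !(mem_cat, inE) mw ?orbT.
have s4 : {subset w4 <= outside} by move=> m mw; rewrite inE !(mem_cat, inE) mw ?orbT.
apply: prev_in_common => [m /vt|| _]; [exact | by apply: val_t; rewrite mem_head|].
do 4!rewrite /= ifF //.
apply: prev_in_common => [m /vt||last2]; [exact | by [] |].
rewrite /=; case: (k =P e1) => // _.
do 4!rewrite /= ifF //.
apply: prev_in_common => [m /vt||last3]; [exact | by [] |].
rewrite /=; case: (k =P e2) => // _.
do 4!rewrite /= ifF //.
by rewrite -[w4]cats0; apply: prev_in_common => [m /vt||last4]; [exact | by [] |].
Qed.

End Word.
Definition tangle_word (o1 o2 o3 : bool) u v x n1 n2 w1 w2 w3 w4 : seq key :=
  three_strands (inr n1) (inr n2) w1 w2 w3 w4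
    (first_of o1 u v) (second_of o1 u v)
    (first_of o2 (mate u) x) (second_of o2 (mate u) x)
    (first_of o3 (mate v) (mate x)) (second_of o3 (mate v) (mate x)).

Definition tangle_keys (u v x : passage) : seq key :=
  [:: inl u; inl v; inl (mate u); inl x; inl (mate v); inl (mate x)].

Lemma perm_tangle_keys o1 o2 o3 u v x :
  perm_eq [:: first_of o1 u v; second_of o1 u v; first_of o2 (mate u) x;
             second_of o2 (mate u) x; first_of o3 (mate v) (mate x);
             second_of o3 (mate v) (mate x)] (tangle_keys u v x).
Proof.
by apply/seq.permP => P; rewrite /first_of /second_of; case: o1 o2 o3 => [] [] [] /=; ring.
Qed.

Lemma tangle_keys_mate u v x k : k \in tangle_keys u v x -> key_mate k \in tangle_keys u v x.
Proof.
rewrite !inE => /orP [/eqP ->|/orP [/eqP ->|/orP [/eqP ->|/orP [/eqP ->|/orP [/eqP ->|/eqP ->]]]]];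
  by rewrite /= ?mateK eqxx ?orbT.
Qed.

Lemma tangle_val_strands E o1 o2 o3 u v x (p : key -> key) val a b c
    (V := fun k => val k : R) :
    {in tangle_keys u v x, forall k,
      val k = key_coef t_mono s_mono E k * val (p k)
              + key_cross t_mono s_mono E k * val (key_mate k)} ->
    [/\ p (first_of o1 u v) = a, p (first_of o2 (mate u) x) = b
      & p (first_of o3 (mate v) (mate x)) = c] ->
    [/\ p (second_of o1 u v) = first_of o1 u v,
        p (second_of o2 (mate u) x) = first_of o2 (mate u) x
      & p (second_of o3 (mate v) (mate x)) = first_of o3 (mate v) (mate x)] ->
  [/\ strand t_mono s_mono o1 (lev u) (lev v) (E (label u)) (E (label v)) (l2r u) (l2r v) (val a)
        (V (inl u)) (V (inl v)) (V (inl (mate u))) (V (inl (mate v))),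
      strand t_mono s_mono o2 (lev (mate u)) (lev x) (E (label u)) (E (label x))
        (l2r (mate u)) (l2r x)
        (val b) (V (inl (mate u))) (V (inl x)) (V (inl u)) (V (inl (mate x)))
    & strand t_mono s_mono o3 (lev (mate v)) (lev (mate x)) (E (label v)) (E (label x))
        (l2r (mate v)) (l2r (mate x)) (val c)
        (V (inl (mate v))) (V (inl (mate x))) (V (inl v)) (V (inl x))].
Proof.
move=> eqs [pa pb pc] [p1 p2 p3].
have := eqs (inl u); have := eqs (inl v); have := eqs (inl (mate u)).
have := eqs (inl x); have := eqs (inl (mate v)); have := eqs (inl (mate x)).
rewrite !inE !eqxx ?orbT => /(_ isT) hmx /(_ isT) hmv /(_ isT) hx /(_ isT) hmu
  /(_ isT) hv /(_ isT) hu.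
rewrite /= !mateK in hmx hmv hx hmu hv hu.
rewrite /V -pa -pb -pc; split.
- move: pa p1; rewrite /first_of /second_of; case: o1 => _ p1; split;
    first [exact: hu | exact: hv | by rewrite hu p1 | by rewrite hv p1].
- move: pb p2; rewrite /first_of /second_of; case: o2 => _ p2; split;
    first [exact: hmu | exact: hx | by rewrite hmu p2 | by rewrite hx p2].
move: pc p3; rewrite /first_of /second_of; case: o3 => _ p3; split;
    first [exact: hmv | exact: hmx | by rewrite hmv p3 | by rewrite hmx p3].
Qed.

Lemma bead_det_omega3 E o1 o2 o3 u v x n1 n2 w1 w2 w3 w4
    (w := tangle_word o1 o2 o3 u v x n1 n2 w1 w2 w3 w4)
    (w' := tangle_word (~~ o1) (~~ o2) (~~ o3) u v x n1 n2 w1 w2 w3 w4) :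
    triangle o1 o2 o3 u v x -> third_move_levels u v x ->
    uniq (infinity :: w) -> matched_keys w ->
  bead_det t_mono s_mono E w = bead_det t_mono s_mono E w'.
Proof.
move=> tri lvl Uw mw.
set t := outside (inr n1) (inr n2) w1 w2 w3 w4.
pose S o1 o2 o3 := tangle_order u v x [:: first_of o1 u v; second_of o1 u v]
  [:: first_of o2 (mate u) x; second_of o2 (mate u) x]
  [:: first_of o3 (mate v) (mate x); second_of o3 (mate v) (mate x)].
have pS p1 p2 p3 : perm_eq (S p1 p2 p3) (tangle_keys u v x).
  by apply: perm_trans (perm_tangle_order _ _ _ _ _ _) _; exact: perm_tangle_keys.
have pT p1 p2 p3 :
    perm_eq (infinity :: tangle_word p1 p2 p3 u v x n1 n2 w1 w2 w3 w4) (tangle_keys u v x ++ t).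
  apply: perm_trans (perm_three_strands _ _ _ _ _ _ _ _ _ _ _ _) _.
  by rewrite perm_cat2r perm_tangle_keys.
have pW p1 p2 p3 :
    perm_eq (infinity :: tangle_word p1 p2 p3 u v x n1 n2 w1 w2 w3 w4) (S p1 p2 p3 ++ t).
  by apply: perm_trans (pT _ _ _) _; rewrite perm_cat2r perm_sym.
have Ust : uniq (tangle_keys u v x ++ t) by rewrite -(perm_uniq (pT o1 o2 o3)).
have [Us Dt] : uniq (tangle_keys u v x) /\ {in t, forall k, k \notin tangle_keys u v x}.
  by move: Ust; rewrite cat_uniq => /and3P [? /hasPn].
have Uw' : uniq (infinity :: w') by rewrite (perm_uniq (pT _ _ _)).
have mw' : matched_keys w'.
  have ww' : w =i w'.
    apply: perm_mem; rewrite -(perm_cons infinity); apply: perm_trans (pT _ _ _) _.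
    by rewrite perm_sym; exact: pT.
  by move=> k; rewrite -!ww' => /mw; case: k => [y|//]; rewrite -!ww'.
have a_t : last infinity w1 \in t by rewrite /t /outside -cat_cons mem_cat mem_last.
have b_t : (inr n1 : key) \in t by rewrite inE !(mem_cat, inE) eqxx !orbT.
have c_t : (inr n2 : key) \in t by rewrite inE !(mem_cat, inE) eqxx !orbT.
have acy p1 p2 p3 (z := tangle_word p1 p2 p3 u v x n1 n2 w1 w2 w3 w4) :
    uniq (infinity :: z) ->
    acyclic (key_cross t_mono s_mono E) key_mate (prev_in infinity z) (S p1 p2 p3).
  move=> Uz; have [pf pg] := prev_three_strands Uz.
  apply: acyclic_tangle pf pg => // k kabc; apply: Dt.
  by rewrite !inE in kabc; case/or3P: kabc => /eqP ->.
apply: (wdet_replace _ (s := S o1 o2 o3) (s' := S (~~ o1) (~~ o2) (~~ o3)) (t := t)) => //.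
- exact: matched_closed.
- exact: pW.
- exact: (acy o1 o2 o3 Uw).
- exact: matched_closed.
- exact: pW.
- exact: (acy _ _ _ Uw').
- move=> k kt; have kw : k \in infinity :: w by rewrite (perm_mem (pT _ _ _)) mem_cat kt orbT.
  have [|h] := matched_cons t_mono s_mono E mw kw; [by left|right].
  move: h; rewrite (perm_mem (pT _ _ _)) mem_cat => /orP [|//].
  move/tangle_keys_mate; have -> : key_mate (key_mate k) = k.
    by case: (k) => //= y; rewrite mateK.
  by rewrite (negPf (Dt _ kt)).
move=> val val' [vals valt] [vals' valt'] k kt.
have val_t : {in t, forall m, val m =1 val' m}.
  move=> m mt j; rewrite valt ?valt' // (perm_mem (pS _ _ _)); exact: Dt.
have eqs j : {in tangle_keys u v x, forall k, val k j = key_coef t_mono s_mono E k *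
    val (prev_in infinity w k) j + key_cross t_mono s_mono E k * val (key_mate k) j}.
  by move=> m; rewrite -(perm_mem (pS o1 o2 o3)) => /vals ->.
have eqs' j : {in tangle_keys u v x, forall k, val' k j = key_coef t_mono s_mono E k *
    val' (prev_in infinity w' k) j + key_cross t_mono s_mono E k * val' (key_mate k) j}.
  by move=> m; rewrite -(perm_mem (pS (~~ o1) (~~ o2) (~~ o3))) => /vals' ->.
(* The inputs of the three strands are outside keys, hence have the same values in both words, and
   [strand_omega3] compares the outputs. *)
have ends j : [/\ val (second_of o1 u v) j = val' (second_of (~~ o1) u v) j,
    val (second_of o2 (mate u) x) j = val' (second_of (~~ o2) (mate u) x) j
  & val (second_of o3 (mate v) (mate x)) j = val' (second_of (~~ o3) (mate v) (mate x)) j].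
  have [pf pg] := prev_three_strands Uw; have [pf' pg'] := prev_three_strands Uw'.
  have [s1 s2 s3] := @tangle_val_strands E o1 o2 o3 u v x _ (val^~ j) _ _ _ (eqs j) pf pg.
  have [s1' s2' s3'] := @tangle_val_strands E _ _ _ u v x _ (val'^~ j) _ _ _ (eqs' j) pf' pg'.
  rewrite -(val_t _ a_t) in s1'; rewrite -(val_t _ b_t) in s2'; rewrite -(val_t _ c_t) in s3'.
  have [] := strand_omega3 t_mono_inv t_mono_rel s_mono_inv tri lvl s1 s2 s3 s1' s2' s3'.
  by rewrite /second_of; case: (o1) (o2) (o3) => [] [] [].
have k_s p1 p2 p3 : k \notin [:: first_of p1 u v; second_of p1 u v; first_of p2 (mate u) x;
    second_of p2 (mate u) x; first_of p3 (mate v) (mate x); second_of p3 (mate v) (mate x)].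
  by rewrite (perm_mem (perm_tangle_keys _ _ _ _ _ _)); exact: Dt.
by apply: walk_three_strands; rewrite ?k_s //; split=> j; case: (ends j).
Qed.

End ThreeStrands.

(** * Words that pass every crossing twice *)

Section WellFormed.
Implicit Types (w : seq passage) (x y : passage).

Definition of_label (l : nat) : pred passage := fun y => label y == l.

(** Reads earliness off the subword of the passages labelled [l], so that it is preserved by any
    move that preserves this subword. *)
Definition early w (l : nat) : bool :=
  if [seq y <- w | label y == l] is a :: _ then lev a == Over else false.

Lemma well_formed_pair w x : well_formed w -> x \in w ->
  [seq y <- w | label y == label x] = [:: x; mate x] \/
  [seq y <- w | label y == label x] = [:: mate x; x].
Proof.
move=> /allP wf xw; have := wf x xw.
have : x \in [seq y <- w | label y == label x] by rewrite mem_filter eqxx.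
case: [seq _ <- _ | _] => [//|a [//|b [|//]]] xab /and3P [/eqP lb /eqP vb /eqP sb].
have bE : b = mate a by case: b lb vb sb {xab} => n l g /= -> -> ->.
by move: xab; rewrite bE !inE => /orP [] /eqP ->; [left | right; rewrite mateK].
Qed.

Lemma count_mem_uniq (K : eqType) (s : seq K) :
  (forall k, (count_mem k s <= 1)%N) -> uniq s.
Proof.
elim: s => //= k s IH cs; apply/andP; split.
  by rewrite -has_pred1 has_count -leqNgt; have := cs k; rewrite eqxx ltnS.
by apply: IH => j; apply: leq_trans (cs j); apply: leq_addl.
Qed.

Lemma well_formed_uniq w : well_formed w -> uniq w.
Proof.
move=> wf; apply: count_mem_uniq => x.
case: (boolP (x \in w)) => [xw|/count_memPn -> //].
have -> : count_mem x w = count_mem x [seq y <- w | label y == label x].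
  by rewrite count_filter; apply: eq_count => y /=; case: eqP => // ->; rewrite eqxx.
by case: (well_formed_pair wf xw) => ->; rewrite /= eqxx (negPf (mate_neq x)).
Qed.

Lemma well_formed_same_label w x y : well_formed w -> x \in w -> y \in w ->
  label y = label x -> y = x \/ y = mate x.
Proof.
move=> wf xw yw lyx; have : y \in [seq z <- w | label z == label x].
  by rewrite mem_filter lyx eqxx.
by case: (well_formed_pair wf xw) => ->; rewrite !inE => /orP [] /eqP ->; [left|right|right|left].
Qed.

(** Both passages with the label lie in [s] and there is no third one. This makes the crossings
    created by a move new to the rest of the word. *)
Lemma well_formed_sep w s r x :
    well_formed w -> perm_eq w (s ++ r) -> x \in s -> mate x \in s ->
  ~~ has (of_label (label x)) r.
Proof.
move=> wf pw xs mxs; apply/hasPn => y yr; apply/negP => /eqP lyx.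
have mw : w =i s ++ r by exact: perm_mem.
have ys : y \notin s.
  move: (well_formed_uniq wf); rewrite (perm_uniq pw) cat_uniq => /and3P [_ /hasPn h _].
  exact: h.
have [] := @well_formed_same_label _ x y wf _ _ lyx; rewrite ?mw ?mem_cat ?xs ?yr ?orbT //.
  by move=> yE; rewrite yE xs in ys.
by move=> yE; rewrite yE mxs in ys.
Qed.

Lemma well_formed_mate w x : well_formed w -> x \in w -> mate x \in w.
Proof.
move=> wf xw; have : mate x \in [seq y <- w | label y == label x].
  by case: (well_formed_pair wf xw) => ->; rewrite !inE eqxx ?orbT.
by rewrite mem_filter => /andP [].
Qed.


Lemma inl_inj : injective (inl : passage -> key). Proof. by move=> x y []. Qed.

Lemma well_formed_matched w : well_formed w -> matched_keys (keys w).
Proof.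
move=> wf k /mapP [x xw ->]; apply: map_f; exact: well_formed_mate.
Qed.

Lemma uniq_keys w : well_formed w -> uniq (infinity :: keys w).
Proof.
move=> wf; rewrite /= (map_inj_uniq inl_inj) well_formed_uniq // andbT.
by apply/mapP => -[].
Qed.

Lemma early_here w1 w2 x : ~~ has (of_label (label x)) w1 ->
  early (w1 ++ x :: w2) (label x) = (lev x == Over).
Proof.
move=> h; rewrite /early filter_cat /= eqxx.
by rewrite (eqP (_ : [seq y <- w1 | label y == label x] == [::])) // -[_ == _]negbK -has_filter.
Qed.

End WellFormed.

(** * Invariance of the determinant of a word up to units *)

Section Moves.
Implicit Types (w : seq passage) (x y : passage).
Variables (R : comNzRingType) (t_mono : bool -> bool -> R) (s_mono : bool -> R).
Hypothesis t_mono_inv : forall e g, t_mono e g * t_mono e (~~ g) = 1.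
Hypothesis t_mono_rel : forall e1 e2 e3 g g3, (1 - t_mono e3 g3) * (t_mono e1 g - t_mono e2 g) = 0.
Hypothesis s_mono_inv : forall g, s_mono g * s_mono (~~ g) = 1.

Definition word_det w : R := bead_det t_mono s_mono (early w) (keys w).

Lemma eq_bead_det (E E' : nat -> bool) w :
  {in w, forall x, E (label x) = E' (label x)} ->
  bead_det t_mono s_mono E (keys w) = bead_det t_mono s_mono E' (keys w).
Proof.
move=> eqE; apply: eq_gdet => k j kw _; rewrite /bead.
by move: kw; rewrite inE => /orP [/eqP ->|/mapP [x xw ->]] //=; rewrite eqE.
Qed.

Lemma early_eq w w' w1 :
    (forall l, has (of_label l) w1 ->
       [seq y <- w | label y == l] = [seq y <- w' | label y == l]) ->
  {in w1, forall x, early w (label x) = early w' (label x)}.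
Proof.
move=> eqf x xw; rewrite /early eqf //; apply/hasP; exists x => //; exact: eqxx.
Qed.

Lemma word_det_rename (f : nat -> nat) w : injective f -> word_det (map (rename f) w) = word_det w.
Proof.
move=> fI.
pose phi (k : key) : key := if k is inl x then inl (rename f x) else k.
have phiI : injective phi.
  move=> [[n l g]|n] [[n' l' g']|n'] //=.
  by case=> fn -> ->; rewrite (fI _ _ fn).
have kE : keys (map (rename f) w) = map phi (keys w) by rewrite -!map_comp.
have prevE d u k : prev_in (phi d) (map phi u) (phi k) = phi (prev_in d u k).
  by elim: u d => //= y u IH d; rewrite (inj_eq phiI); case: eqP.
have earlyE l : early (map (rename f) w) (f l) = early w l.
  rewrite /early filter_map; have -> : [seq y <- w | preim (rename f) (fun y => label y == f l) y]
      = [seq y <- w | label y == l].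
    by apply: eq_filter => y /=; rewrite (inj_eq fI).
  by case: [seq _ <- _ | _].
rewrite /word_det /bead_det /wdet kE -[infinity]/(phi infinity) -map_cons gdet_map.
apply: eq_gdet => k j _ _; rewrite /bead /unitv !prevE !(inj_eq phiI).
have -> : key_mate (phi k) = phi (key_mate k) by case: k.
rewrite (inj_eq phiI); case: k => [x|n] //=.
by rewrite !earlyE.
Qed.

Lemma word_det_omega1 x w1 w2 :
    well_formed (w1 ++ w2) -> well_formed (w1 ++ [:: x; mate x] ++ w2) ->
  word_det (w1 ++ [:: x; mate x] ++ w2) =
  (if lev x is Under then t_mono (early (w1 ++ [:: x; mate x] ++ w2) (label x)) (~~ l2r x) else 1)
  * word_det (w1 ++ w2).
Proof.
move=> wf wf'; set w' := w1 ++ _ ++ w2 in wf' *.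
have xw : x \in w' by rewrite mem_cat !inE eqxx orbT.
rewrite /word_det [in LHS]map_cat /= (bead_det_omega1 t_mono s_mono_inv) -?map_cat; last 2 first.
- by have := uniq_keys wf'; rewrite /w' map_cat.
- exact: well_formed_matched.
congr (_ * _); apply: eq_bead_det; apply: early_eq => l hl.
have pw : perm_eq w' ([:: x; mate x] ++ (w1 ++ w2)).
  by apply/seq.permP => P; rewrite /= !count_cat /=; ring.
have := well_formed_sep wf' pw (mem_head _ _); rewrite !inE eqxx orbT => /(_ isT).
rewrite /w' !filter_cat /=; case: eqP => // ->; by rewrite hl.
Qed.

Lemma uniq_insert (w1 w2 : seq key) n :
    (0 < n)%N -> inr n \notin w1 ++ w2 -> uniq (infinity :: w1 ++ w2) ->
  uniq (infinity :: w1 ++ inr n :: w2).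
Proof.
move=> n0 nw Uw.
rewrite (@perm_uniq _ _ (inr n :: infinity :: w1 ++ w2)).
  by rewrite cons_uniq Uw andbT inE negb_or nw andbT; case: n n0 {nw}.
by apply/seq.permP => P; rewrite /= !count_cat /=; ring.
Qed.

Lemma inr_keys n w : (inr n : key) \notin keys w.
Proof. by apply/mapP => -[]. Qed.

Lemma word_det_omega2 (parallel : bool) x y w1 w2 w3
    (w := w1 ++ w2 ++ w3)
    (w' := w1 ++ [:: x; y] ++ w2 ++ in_order parallel (mate x) (mate y) ++ w3) :
    lev x = lev y -> l2r x <> l2r y -> well_formed w -> well_formed w' ->
  word_det w' = word_det w.
Proof.
move=> lxy gxy wf wf'.
pose f := if parallel then mate x else mate y.
pose g := if parallel then mate y else mate x.
have fg : in_order parallel (mate x) (mate y) = [:: f; g] by rewrite /f /g; case: (parallel).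
have fgE : [:: f; g] = [:: mate x; mate y] \/ [:: f; g] = [:: mate y; mate x].
  by rewrite /f /g; case: (parallel); [left | right].
have pw : perm_eq w' ([:: x; y; mate x; mate y] ++ w).
  rewrite /w' /w /in_order; apply/seq.permP => P.
  by case: (parallel); rewrite /= !count_cat /= !count_cat /=; ring.
have nx := well_formed_sep wf' pw (mem_head _ _).
have ny := @well_formed_sep _ _ _ y wf' pw.
rewrite !inE !eqxx !orbT in nx ny; move: (nx isT) (ny isT isT) => {}nx {}ny.
have early_w : {in w, forall z, early w' (label z) = early w (label z)}.
  apply: early_eq => l hl; rewrite /w' /w !filter_cat fg /=.
  have [lx ly] : label x != l /\ label y != l.
    by split; apply: contraTneq hl => <-.
  have [lf lg] : label f != l /\ label g != l by rewrite /f /g; case: (parallel).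
  by rewrite (negPf lx) (negPf ly) (negPf lf) (negPf lg).
rewrite [in RHS]/word_det -(eq_bead_det early_w).
(* Both new crossings are first met on the strand of [x] and [y], and at the same level, so they are
   early overcrossings together or not at all. *)
have early_xy : early w' (label x) = early w' (label y).
  have Us : uniq [:: x; y; mate x; mate y].
    by move: (well_formed_uniq wf'); rewrite (perm_uniq pw) cat_uniq => /and3P [].
  have yx : label y != label x.
    apply/eqP => eqyx; have yw : y \in w' by rewrite (perm_mem pw) !inE eqxx orbT.
    have xw : x \in w' by rewrite (perm_mem pw) mem_head.
    by case: (well_formed_same_label wf' xw yw eqyx) => yE;
      move: Us; rewrite yE /= !inE !eqxx ?orbT ?andbF.
  have nl l : ~~ has (of_label l) w -> ~~ has (of_label l) w1.
    by rewrite /w has_cat negb_or => /andP [].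
  rewrite (early_here _ (nl _ nx)) /w' -[_ ++ _]/(w1 ++ [:: x] ++ y :: _) catA early_here ?lxy //.
  by rewrite has_cat negb_or nl //= orbF /of_label eq_sym.
have gyx : l2r y = ~~ l2r x by case: (l2r x) (l2r y) gxy => [] [].
have w'E : keys w' = (keys w1 ++ [:: inl x, inl y & keys w2]) ++ [:: inl f, inl g & keys w3].
  by rewrite /w' fg !map_cat /= -catA.
have wE : keys w = (keys w1 ++ keys w2) ++ keys w3 by rewrite /w !map_cat catA.
(* A separator is put in front of the second strand in both words, where [bead_det_omega2] expects
   it. *)
rewrite /word_det w'E wE -(@bead_det_separator _ _ _ _ _ _ 1) -?w'E; last 2 first.
- by apply: uniq_insert; rewrite -?w'E ?inr_keys ?uniq_keys.
- exact: well_formed_matched.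
rewrite -(@bead_det_separator _ _ _ _ (keys w1 ++ keys w2) _ 1) -?wE; last 2 first.
- by apply: uniq_insert; rewrite -?wE ?inr_keys ?uniq_keys.
- exact: well_formed_matched.
rewrite -!catA /= (bead_det_omega2 t_mono_inv s_mono_inv lxy gyx early_xy fgE) //.
- have := @uniq_insert (keys w1 ++ [:: inl x, inl y & keys w2]) [:: inl f, inl g & keys w3] 1.
  by rewrite -w'E inr_keys uniq_keys // -catA => /(_ isT isT isT).
- by rewrite catA -wE; exact: well_formed_matched.
Qed.

Definition omega3_word (o1 o2 o3 : bool) u v x w1 w2 w3 w4 : seq passage :=
  w1 ++ in_order o1 u v ++ w2 ++ in_order o2 (mate u) x
     ++ w3 ++ in_order o3 (mate v) (mate x) ++ w4.

Lemma keys_in_order o y z : keys (in_order o y z) = [:: first_of o y z; second_of o y z].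
Proof. by case: o. Qed.

Lemma omega3_word_separated E o1 o2 o3 u v x w1 w2 w3 w4
    (w := omega3_word o1 o2 o3 u v x w1 w2 w3 w4)
    (t := tangle_word o1 o2 o3 u v x 1 2 (keys w1) (keys w2) (keys w3) (keys w4)) :
    well_formed w ->
  [/\ uniq (infinity :: t), matched_keys t
    & bead_det t_mono s_mono E t = bead_det t_mono s_mono E (keys w)].
Proof.
move=> wf.
pose a := keys w1 ++ keys (in_order o1 u v) ++ keys w2.
pose b := keys (in_order o2 (mate u) x) ++ keys w3.
pose c := keys (in_order o3 (mate v) (mate x)) ++ keys w4.
have wE : keys w = a ++ b ++ c by rewrite /w /omega3_word /a /b /c !map_cat -!catA.
have tE : t = (a ++ inr 1 :: b) ++ inr 2 :: c.
  by rewrite /a /b /c !keys_in_order /t /tangle_word /three_strands -!catA /= -?catA.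
have U1 : uniq (infinity :: a ++ inr 1 :: (b ++ c)).
  by apply: uniq_insert; rewrite -?wE ?inr_keys ?uniq_keys.
have U2 : uniq (infinity :: (a ++ inr 1 :: b) ++ inr 2 :: c).
  apply: uniq_insert => //; last by rewrite -catA.
  by rewrite /a /b /c !(mem_cat, inE) /= !(negPf (inr_keys _ _)).
have mw := well_formed_matched wf; rewrite wE in mw.
have insert_matched (s1 s2 : seq key) n :
    matched_keys (s1 ++ s2) -> matched_keys (s1 ++ inr n :: s2).
  by move=> ms [z|//]; have := ms (inl z); rewrite !mem_cat !inE.
have m1 := insert_matched _ _ 1%N mw.
have m2 : matched_keys ((a ++ inr 1 :: b) ++ inr 2 :: c) by apply: insert_matched; rewrite -catA.
rewrite tE; split=> //.
rewrite wE (bead_det_separator t_mono s_mono E U2) -catA //.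
exact: bead_det_separator U1 mw.
Qed.

Lemma word_det_omega3 o1 o2 o3 u v x w1 w2 w3 w4
    (w := omega3_word o1 o2 o3 u v x w1 w2 w3 w4)
    (w' := omega3_word (~~ o1) (~~ o2) (~~ o3) u v x w1 w2 w3 w4) :
    triangle o1 o2 o3 u v x -> third_move_levels u v x ->
    well_formed w -> well_formed w' ->
  word_det w' = word_det w.
Proof.
move=> tri lvl wf wf'.
have pw : perm_eq w ([:: u; v; mate u; x; mate v; mate x] ++ w1 ++ w2 ++ w3 ++ w4).
  rewrite /w /omega3_word /in_order; apply/seq.permP => P.
  by case: (o1) (o2) (o3) => [] [] []; do !rewrite !count_cat /=; ring.
have Us : uniq [:: u; v; mate u; x; mate v; mate x].
  by move: (well_formed_uniq wf); rewrite (perm_uniq pw) cat_uniq => /and3P [].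
have distinct y z : y \in w -> z \in w -> z != y -> z != mate y -> label z != label y.
  move=> yw zw zy zmy; apply/eqP => /(well_formed_same_label wf yw zw) [] /eqP; exact/negP.
have inw y : y \in [:: u; v; mate u; x; mate v; mate x] -> y \in w.
  by rewrite (perm_mem pw) mem_cat => ->.
move: Us; rewrite !cons_uniq !inE !negb_or => Us; split_ands.
have lvu : label v != label u by apply: distinct; rewrite ?inw ?inE ?eqxx ?orbT // eq_sym.
have lxu : label x != label u by apply: distinct; rewrite ?inw ?inE ?eqxx ?orbT // eq_sym.
have lxv : label x != label v by apply: distinct; rewrite ?inw ?inE ?eqxx ?orbT // eq_sym.
(* The move only swaps neighbouring passages of distinct crossings, so the two passages of any one
   crossing keep their order. *)
have early_w : {in w, forall z, early w (label z) = early w' (label z)}.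
  apply: early_eq => l _; rewrite /w /w' /omega3_word !filter_cat.
  have swap o y z : label z != label y ->
      [seq k <- in_order (~~ o) y z | label k == l] = [seq k <- in_order o y z | label k == l].
    move=> lzy; case: o => /=; case: (label y =P l) => [<-|]; rewrite ?(negPf lzy) //.
  by rewrite !swap.
rewrite /word_det /w'; have [_ _ <-] := omega3_word_separated (early w') wf'.
rewrite [RHS](eq_bead_det early_w).
have [Ut mt <-] := omega3_word_separated (early w') wf.
by rewrite (bead_det_omega3 t_mono_inv t_mono_rel s_mono_inv _ tri lvl Ut mt).
Qed.

Lemma word_det_move w w' : well_formed w -> well_formed w' -> move w w' ->
  word_det w' = word_det w \/ exists e g, word_det w' = t_mono e g * word_det w.
Proof.
move=> + + mv; case: mv => {w w'}.
- by move=> f w fI _ _; left; exact: word_det_rename.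
- move=> x w1 w2 wf wf'; rewrite (word_det_omega1 wf wf').
  by case: (lev x); [left; rewrite mul1r | right; do 2!eexists | left; rewrite mul1r].
- by move=> par x y w1 w2 w3 lxy gxy wf wf'; left; exact: word_det_omega2.
by move=> o1 o2 o3 u v x w1 w2 w3 w4 tri lvl wf wf'; left; exact: word_det_omega3.
Qed.

End Moves.

(** * Degrees in the Laurent polynomials *)

Section GroupAlgebraFacts.
Variables (K : zmodType) (R : comNzRingType).
Implicit Types f g : galg K R.

Lemma galgUU (c d : R) (i j : K) :
  (<< c *g i >> : galg K R) * << d *g j >> = << c * d *g i + j >>.
Proof. exact: galg_mulUU. Qed.

Lemma galg_coef_sum (I : Type) (r : seq I) (P : pred I) (F : I -> galg K R) k :
  (\sum_(i <- r | P i) F i)@_k = \sum_(i <- r | P i) (F i)@_k.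
Proof.
elim/big_rec2: _ => [|i a f _ <-]; first exact: mcoeff0.
exact: mcoeffD.
Qed.

Lemma galg_coefM f g k :
  (f * g)@_k = \sum_(i <- msupp f) \sum_(j <- msupp g) f@_i * g@_j *+ (i + j == k).
Proof.
rewrite {1}/GRing.mul /= galg_mulE galg_coef_sum; apply: eq_bigr => i _.
by rewrite galg_coef_sum; apply: eq_bigr => j _; rewrite mcoeffU.
Qed.

Lemma galg_coefUM (c : R) f k : ((<< c *g 0 >> : galg K R) * f)@_k = c * f@_k.
Proof.
rewrite [in LHS](galgE f) mulr_sumr galg_coef_sum [in RHS](galgE f) galg_coef_sum mulr_sumr.
by apply: eq_bigr => i _; rewrite galgUU add0r !mcoeffU mulrnAr.
Qed.

End GroupAlgebraFacts.

Section Degree.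
Variable R : comNzRingType.
Implicit Types (f g : galg int R) (m : int).

Definition deg_le f m : Prop := forall e : int, m < e -> f@_e = 0.

Lemma deg_le0 m : deg_le 0 m. Proof. by move=> e _; exact: mcoeff0. Qed.

Lemma deg_leW f m m' : m <= m' -> deg_le f m -> deg_le f m'.
Proof. by move=> le h e /(le_lt_trans le); exact: h. Qed.

Lemma deg_leU (c : R) k m : k <= m -> deg_le << c *g k >> m.
Proof.
by move=> km e me; rewrite mcoeffU (lt_eqF (le_lt_trans km me)).
Qed.

Lemma deg_leD f g m : deg_le f m -> deg_le g m -> deg_le (f + g) m.
Proof. by move=> hf hg e me; rewrite mcoeffD hf // hg // addr0. Qed.

Lemma deg_leN f m : deg_le f m -> deg_le (- f) m.
Proof. by move=> hf e me; rewrite mcoeffN hf // oppr0. Qed.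

Lemma deg_leM f g m m' : deg_le f m -> deg_le g m' -> deg_le (f * g) (m + m').
Proof.
move=> hf hg e me; rewrite galg_coefM big1 // => i _; rewrite big1 // => j _.
case: (ltP m i) => [/hf ->|im]; first by rewrite mul0r mul0rn.
case: (ltP m' j) => [/hg ->|jm]; first by rewrite mulr0 mul0rn.
by rewrite (lt_eqF (le_lt_trans (lerD im jm) me)).
Qed.

Lemma deg_le_sum (I : Type) (r : seq I) (P : pred I) (F : I -> galg int R) m :
  (forall i, P i -> deg_le (F i) m) -> deg_le (\sum_(i <- r | P i) F i) m.
Proof.
move=> h; elim/big_rec: _ => [|i f Pi hf]; first exact: deg_le0.
by apply: deg_leD => //; apply: h.
Qed.

Lemma deg_le_prod (I : Type) (r : seq I) (P : pred I) (F : I -> galg int R) (m : I -> int) :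
  (forall i, P i -> deg_le (F i) (m i)) ->
  deg_le (\prod_(i <- r | P i) F i) (\sum_(i <- r | P i) m i).
Proof.
move=> h; elim/big_rec2: _ => [|i f k Pi hf]; first exact: deg_leU.
by apply: deg_leM => //; apply: h.
Qed.

(** Each term of the Leibniz expansion takes one entry from every row, so the bounds of the rows add
    up. *)
Lemma deg_le_det n (A : 'M[galg int R]_n) (m : 'I_n -> int) :
  (forall i j, deg_le (A i j) (m i)) -> deg_le (\det A) (\sum_i m i).
Proof.
move=> h; rewrite /determinant; apply: deg_le_sum => s _; rewrite mulr_sign.
by case: (odd_perm s); [apply: deg_leN|]; apply: deg_le_prod.
Qed.

Lemma deg_le_gdet (K : eqType) (x0 : K) (ks : seq K) (F : K -> K -> galg int R) (m : K -> int) :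
    {in ks &, forall k j, deg_le (F k j) (m k)} ->
  deg_le (gdet x0 ks F) (\sum_(k <- ks) m k).
Proof.
move=> h; rewrite (big_nth x0) big_mkord; apply: deg_le_det => i j.
by rewrite mxE; apply: h; rewrite mem_nth.
Qed.

End Degree.

(** * The units p and q of T and the relations between them *)

Lemma pq_relations (R : comNzRingType) (t : bool -> bool -> R) :
    (forall e g, t e g * t e (~~ g) = 1) ->
    (t true true - 1) * (t true true - t false true) = 0 ->
    (t false true - 1) * (t true true - t false true) = 0 ->
  forall e1 e2 e3 g g3, (1 - t e3 g3) * (t e1 g - t e2 g) = 0.
Proof.
move=> inv relp relq e1 e2 e3 g g3.
have pp := inv true true; have qq := inv false true; rewrite /= in pp qq.
pose d := t true true - t false true.
have kill e' g' : (1 - t e' g') * d = 0.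
  have inv_kill a b : a * b = 1 -> (1 - a) * d = 0 -> (1 - b) * d = 0.
    move=> ab h; transitivity (- b * ((1 - a) * d)); last by rewrite h mulr0.
    ring: ab.
  have [hp hq] : (1 - t true true) * d = 0 /\ (1 - t false true) * d = 0.
    by split; rewrite -opprB mulNr ?relp ?relq oppr0.
  by case: e' g' => [] [] //; [exact: inv_kill pp hp | exact: inv_kill qq hq].
(* The identity p^-1 - q^-1 = - (p q)^-1 (p - q) makes the difference a multiple of p - q for either
   exponent. *)
have [c dE] : exists c, t true g - t false g = c * d.
  case: g; first by exists 1; rewrite mul1r.
  by exists (- (t true false * t false false)); rewrite /d; ring: pp qq.
case: e1 e2 => [] []; rewrite ?subrr ?mulr0 //; last rewrite -[t false g - _]opprB mulrN.
  by rewrite dE mulrCA kill mulr0.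
by rewrite dE mulrCA kill mulr0 oppr0.
Qed.

Lemma toT_M f g : toT (f * g) = toT f * toT g. Proof. exact: rmorphM. Qed.
Lemma toT_B f g : toT (f - g) = toT f - toT g. Proof. exact: rmorphB. Qed.
Lemma toT_1 : toT 1 = 1. Proof. exact: rmorph1. Qed.

Lemma toT_ideal f : f \in T_ideal -> toT f = 0.
Proof.
rewrite -[f in X in X -> _]subr0 Quotient.idealrBE => /eqP eqf.
by rewrite /toT eqf; exact: rmorph0.
Qed.

Definition sgz_bool (g : bool) : int := if g then 1 else -1.

Definition t_coef (e g : bool) : T := if e then T_p (sgz_bool g) else T_q (sgz_bool g).

Lemma t_coef_inv e g : t_coef e g * t_coef e (~~ g) = 1.
Proof.
by case: e g => [] []; rewrite /t_coef /T_p /T_q -toT_M galgUU mulr1 -toT_1; congr toT.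
Qed.

Lemma T_rel_p : (t_coef true true - 1) * (t_coef true true - t_coef false true) = 0.
Proof.
rewrite -toT_1 -!toT_B -toT_M; apply: toT_ideal; apply/asboolP.
by exists 1, 0; rewrite mul1r mul0r addr0.
Qed.

Lemma T_rel_q : (t_coef false true - 1) * (t_coef true true - t_coef false true) = 0.
Proof.
rewrite -toT_1 -!toT_B -toT_M; apply: toT_ideal; apply/asboolP.
by exists 0, 1; rewrite mul1r mul0r add0r.
Qed.

Lemma t_coef_rel e1 e2 e3 g g3 : (1 - t_coef e3 g3) * (t_coef e1 g - t_coef e2 g) = 0.
Proof. exact: pq_relations t_coef_inv T_rel_p T_rel_q _ _ _ _ _. Qed.


Local Notation laurent := (galg int T).

Definition t_mono (e g : bool) : laurent := << t_coef e g *g 0 >>.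
Definition s_mono (g : bool) : laurent := << 1 *g sgz_bool g >>.

Lemma t_mono_inv e g : t_mono e g * t_mono e (~~ g) = 1.
Proof. by rewrite /t_mono galgUU t_coef_inv addr0. Qed.

Lemma t_mono_rel e1 e2 e3 g g3 : (1 - t_mono e3 g3) * (t_mono e1 g - t_mono e2 g) = 0.
Proof.
rewrite /t_mono -[1]/(<< 1 *g 0 >> : laurent) -!monalgUB galgUU t_coef_rel.
exact: monalgU0.
Qed.

Lemma s_mono_inv g : s_mono g * s_mono (~~ g) = 1.
Proof. by case: g; rewrite /s_mono galgUU mul1r. Qed.

Local Notation zeta_word := (word_det t_mono s_mono).

(** The factor is recorded with its inverse, both to reverse moves and because multiplication by it
    must not annihilate a nonzero coefficient of T. *)
Lemma zeta_word_move w w' : well_formed w -> well_formed w' -> move w w' ->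
  exists2 cc : T * T, cc.1 * cc.2 = 1 &
    zeta_word w' = (<< cc.1 *g 0 >> : laurent) * zeta_word w.
Proof.
move=> wf wf' /(word_det_move t_mono_inv t_mono_rel s_mono_inv wf wf') [->|[e [g ->]]].
  exists (1, 1) => /=; first exact: mulr1.
  by rewrite -[<< 1 *g 0 >>]/(1 : laurent) mul1r.
by exists (t_coef e g, t_coef e (~~ g)) => //=; exact: t_coef_inv.
Qed.

Definition virtual_l2r : pred passage := fun x => (lev x == Virtual) && l2r x.

(** A row bound: the coefficients of a row have degree at most 0, except that s itself occurs at a
    virtual passage from left to right. *)
Lemma deg_le_zeta_word w : deg_le (zeta_word w) (count virtual_l2r w)%:Z.
Proof.
pose m (k : passage + nat) : int := if k is inl x then (virtual_l2r x)%:Z else 0.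
have -> : (count virtual_l2r w)%:Z = \sum_(k <- infinity :: map inl w) m k.
  rewrite big_cons add0r big_map; elim: w => [|x w IH]; first by rewrite big_nil.
  by rewrite big_cons /= PoszD IH.
apply: deg_le_gdet => k j _ _; rewrite /bead.
have unit_deg (a b : (passage + nat)%type) : deg_le (unitv laurent a b) 0.
  by rewrite /unitv; case: eqP => _; [exact: deg_leU | exact: deg_le0].
have m0 : 0 <= m k by case: (k).
have coef_deg : deg_le (key_coef t_mono s_mono (early w) k) (m k).
  case: k m0 => [[n [] g]|n] _ /=; try exact: deg_leU.
  by case: g; exact: deg_leU.
have cross_deg : deg_le (key_cross t_mono s_mono (early w) k) (m k).
  case: k m0 {coef_deg} => [[n [] g]|n] _ /=; try exact: deg_le0.
  by apply: deg_leD; [|apply: deg_leN]; exact: deg_leU.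
rewrite -[m k]addr0; apply: deg_leD; first apply: deg_leD.
- by apply: (deg_leW _ (unit_deg _ _)); rewrite addr0.
- by apply: deg_leN; exact: deg_leM coef_deg (unit_deg _ _).
by apply: deg_leN; exact: deg_leM cross_deg (unit_deg _ _).
Qed.

(** The two passages of a crossing have opposite [l2r], so no virtual crossing is counted twice. *)
Lemma count_virtual_l2r (D : diagram) : (count virtual_l2r (code D) <= num_virtual D)%N.
Proof.
have /andP [wf _] := codeP D; rewrite /num_virtual /virtual_crossings.
move: (code D) wf => w wf.
rewrite -size_filter -(size_map label); apply: uniq_leq_size.
  rewrite map_inj_in_uniq ?filter_uniq ?well_formed_uniq // => x y.
  rewrite !mem_filter => /andP [/andP [_ gx] xw] /andP [/andP [_ gy] yw] lxy.
  have [//|xE] := well_formed_same_label wf yw xw lxy.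
  by move: gx; rewrite xE /= gy.
move=> l /mapP [x]; rewrite mem_filter => /andP [/andP [vx _] xw] ->.
by rewrite mem_undup map_f // mem_filter vx.
Qed.

(** * Comparison with zeta *)

Definition is_under : pred passage := fun x => lev x == Under.
Definition not_over : pred passage := fun x => lev x != Over.

Lemma split_last_under w : has is_under w ->
  exists w1 u w2, [/\ w = w1 ++ u :: w2, lev u = Under & ~~ has is_under w2].
Proof.
elim: w => //= x w IH; case: (boolP (has is_under w)) => [/IH [w1 [u [w2 [-> lu h2]]]] _|h].
  by exists (x :: w1), u, w2.
by rewrite orbF => /eqP lx; exists [::], x, w.
Qed.

Lemma foldl_next_deg_filter d w : foldl next_deg d (filter not_over w) = foldl next_deg d w.
Proof.
elim: w d => //= x w IH d; rewrite /not_over; case: (lev x =P Over) => [lx|_] /=; last exact: IH.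
by rewrite -IH /next_deg lx.
Qed.

Lemma under_labels_filter w : under_labels (filter not_over w) = under_labels w.
Proof.
rewrite /under_labels -filter_predI; congr map; apply: eq_filter => x /=.
by rewrite /not_over; case: (lev x).
Qed.

(* Degree and source of the long arc on which the prefix [y] of [w] ends, if   *)
(* [u] is the last undercrossing of [w].                                       *)
Definition prefix_deg (w y : seq passage) : int := foldl next_deg (foldl next_deg 0 w) y.
Definition prefix_source (u : passage) (y : seq passage) : passage :=
  last u (filter is_under y).

(** The value carried by an arc of degree [g] on the long arc emanating from [a]: s^g times the
    unknown leaving the underpass [a]. *)
Definition arc_value (g : int) (a : passage) (j : key) : laurent :=
  (<< 1 *g g >> : laurent) * unitv laurent (inl a) j.

(** * Elimination of all unknowns but those leaving underpasses *)

Section Elimination.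
Variables (w1 w2 : seq passage) (u : passage).
Let w := w1 ++ u :: w2.
Hypotheses (wf : well_formed w) (lev_u : lev u = Under) (no_under : ~~ has is_under w2).

Lemma deg_at_end : foldl next_deg 0 w = foldl next_deg 0 w2.
Proof. by rewrite /w foldl_cat /= {2}/next_deg lev_u. Qed.

Let E := early w.
Let p := prev_in infinity (keys w).

Let not_under (k : key) : bool := if k is inl x then ~~ is_under x else true.
(** The closed curve is cut at the last underpass [u], so that the order follows the united long
    arc: first gamma_+, then infinity, then gamma_-. Off the underpasses a key depends only on its
    predecessor, which makes this order acyclic. *)
Let s := filter not_under (keys w2 ++ infinity :: keys w1).

Let in_s k : (k \in s) = not_under k && (k \in infinity :: keys w).
Proof.
rewrite mem_filter /w !map_cat /= !(mem_cat, inE); case: k => [x|n] //=; last by do !bool_congr.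
case: (boolP (is_under x)) => //= ux; do !bool_congr.
case: eqP => [/inl_inj xu|]; last by rewrite orbF.
by rewrite /is_under xu lev_u in ux.
Qed.

Let perm_s : perm_eq (infinity :: keys w) (s ++ keys (filter is_under w)).
Proof.
have -> : keys (filter is_under w) = filter (predC not_under) (infinity :: keys w).
  by rewrite /= filter_map; congr map; apply: eq_filter => x; rewrite /= negbK.
rewrite perm_sym; apply: perm_trans (permEl (perm_filterC not_under (infinity :: keys w))).
rewrite perm_cat2r /s /w map_cat; do !rewrite filter_cat /=.
have -> : is_under u by rewrite /is_under lev_u.
by apply/seq.permP => P; rewrite /= !count_cat /=; ring.
Qed.

Let uniq_w : uniq (infinity :: keys w) := uniq_keys wf.

Let p_rot k : k \in s -> p k = prev_in (inl u) (keys w2 ++ infinity :: keys w1) k.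
Proof.
rewrite mem_filter /p /w map_cat /= => /andP [_ ks]; apply: prev_in_rot ks.
by have := uniq_w; rewrite /w map_cat.
Qed.

Let acyclic_s : acyclic (key_cross t_mono s_mono E) key_mate p s.
Proof.
have Ur : uniq ((inl u : key) :: keys w2 ++ infinity :: keys w1).
  rewrite (@perm_uniq _ _ (infinity :: keys w)) //.
  by apply/seq.permP => P; rewrite /w map_cat /= !count_cat /=; ring.
have cross0 k : k \in s -> key_cross t_mono s_mono E k = 0.
  by rewrite mem_filter => /andP []; case: k => [[n [] g]|n].
have sub k : k \in s -> k \in keys w2 ++ infinity :: keys w1 by rewrite mem_filter => /andP [].
apply/andP; split.
  rewrite -(@eq_in_pairwise _ (mem s)
    (fun k j => prev_in (inl u) (keys w2 ++ infinity :: keys w1) k != j)).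
  - by apply: pairwise_filter; exact: prev_in_pairwise.
  - by move=> k j ks _; rewrite /depends cross0 // eqxx orbF p_rot.
  exact: allss.
apply/allP => k ks; rewrite /depends cross0 // eqxx orbF p_rot //.
exact: prev_in_neq (sub _ ks).
Qed.

(** Overpasses transmit values and virtual crossings multiply them by s or s^-1, just as [next_deg]
    updates degrees; an underpass starts afresh with its own unknown. Induction along the curve
    gives the value on every arc. *)
Lemma eliminated : exists val : key -> key -> laurent,
  [/\ forall y z, w = y ++ z ->
        val (last infinity (keys y)) =1 arc_value (prefix_deg w y) (prefix_source u y)
    & zeta_word w = gdet infinity (keys (filter is_under w))
        (reduced (key_coef t_mono s_mono E) (key_cross t_mono s_mono E) key_mate p val)].
Proof.
have [val [vals valt] gdetE] := @wdet_elim _ _ infinity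
  (key_coef t_mono s_mono E) (key_cross t_mono s_mono E) key_mate
  (erefl (0 : laurent)) _ _ _ uniq_w
  (matched_closed t_mono s_mono E (well_formed_matched wf)) perm_s acyclic_s.
exists val; split=> // y z wE.
have walk y1 y2 y3 g a : w = y1 ++ y2 ++ y3 ->
    val (last infinity (keys y1)) =1 arc_value g a ->
    val (last infinity (keys (y1 ++ y2))) =1
      arc_value (foldl next_deg g y2) (last a (filter is_under y2)).
  elim/last_ind: y2 y3 => [|y2 x IH] y3 wE' start; first by rewrite cats0.
  have {}IH := IH (x :: y3) _ start; rewrite -cats1 -catA in wE'.
  have px : prev_in infinity (keys w) (inl x) = last infinity (keys (y1 ++ y2)).
    apply: (@prev_inE _ _ (keys y3) _ _ uniq_w).
    by rewrite wE' !map_cat -!catA.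
  have xw : x \in w by rewrite wE' !mem_cat mem_head !orbT.
  rewrite -rcons_cat map_rcons last_rcons foldl_rcons filter_rcons.
  have [ux|nux] := boolP (is_under x).
    rewrite last_rcons [next_deg _ x]/next_deg (eqP ux) => j.
    rewrite valt ?in_s /= ?ux // /arc_value -[<< 1 *g 0 >>]/(1 : laurent) mul1r //.
  have xs : (inl x : key) \in s by rewrite in_s /= nux inE map_f.
  move=> j; rewrite vals //= px IH ?catA //; last by rewrite -catA.
  move: nux; rewrite /is_under [next_deg _ x]/next_deg /arc_value; case: (lev x) => //= _.
    by rewrite mul1r mul0r addr0.
  rewrite mul0r addr0 mulrA galgUU mulr1 /sgz_bool addrC.
  by case: (l2r x).
(* Walking along gamma_+ from [u], with initial degree 0, gives the value at infinity, which is the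
   input of gamma_-. *)
have at_end : val (last infinity (keys w)) =1 arc_value (foldl next_deg 0 w) u.
  have := walk (w1 ++ [:: u]) w2 [::] 0 u; rewrite cats0 -catA => /(_ (erefl _)).
  have -> : filter is_under w2 = [::] by apply/eqP; rewrite -[_ == _]negbK -has_filter.
  rewrite deg_at_end; apply; rewrite map_cat last_cat /= => j.
  rewrite valt ?in_s /= ?/is_under ?lev_u // /arc_value.
  by rewrite -[<< 1 *g 0 >>]/(1 : laurent) mul1r.
have := walk [::] y z (foldl next_deg 0 w) u wE; apply => j.
rewrite vals ?in_s ?mem_head //= mul1r mul0r addr0 prev_in_notin ?at_end //.
by move: uniq_w => /andP [].
Qed.

End Elimination.

Lemma sum_single n (P : pred 'I_n) (b : 'I_n -> bool) (a0 : 'I_n) (c : T) (d : 'I_n -> int) :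
    (forall a, b a = (a == a0)) ->
  \sum_(a | P a) (<< (b a)%:R * c *g d a >> : laurent) =
  if P a0 then << c *g d a0 >> else 0.
Proof.
move=> bE; rewrite big_mkcond (bigD1 a0) //= big1 ?addr0 => [|a na].
  by rewrite bE eqxx mul1r.
by rewrite bE (negPf na) mul0r; case: ifP => // _; exact: monalgU0.
Qed.

Lemma no_at_level l w y x z : well_formed w -> w = y ++ x :: z -> lev x = l -> l != Virtual ->
  {in y, forall k, ~~ at_level l (label x) k}.
Proof.
move=> wf wE lx lV k ky; apply/negP => /andP [/eqP lk /eqP lbl].
have xw : x \in w by rewrite wE mem_cat mem_head orbT.
have kw : k \in w by rewrite wE mem_cat ky.
have := well_formed_uniq wf; rewrite wE cat_uniq /= negb_or => /and3P [_ /andP [xy _] _].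
have [kE|kE] := well_formed_same_label wf xw kw lbl; first by rewrite -kE ky in xy.
by move: lk lV; rewrite kE /= lx; case: (l).
Qed.

Lemma find_here (A : Type) (P : pred A) s (a : A) t :
  ~~ has P s -> P a -> find P (s ++ a :: t) = size s.
Proof. by move=> nP Pa; rewrite find_cat (negPf nP) /= Pa addn0. Qed.

(** * Entries of the matrix of zeta *)

Section Diagram.
Variables (D : diagram) (w1 w2 : seq passage) (u : passage).
Hypotheses (codeE : code D = w1 ++ u :: w2) (lev_u : lev u = Under)
  (no_under : ~~ has is_under w2).

Let w := code D.
Let wf : well_formed w. Proof. by have /andP [] := codeP D. Qed.

(** The arc reached at the end of the prefix [y]; its number is the number of breaks met so far. *)
Definition arc_of (y : seq passage) : diag_arc D := inord (size (filter not_over y)).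

Section Prefix.
Variables y z : seq passage.
Hypothesis wE : w = y ++ z.

Lemma breaks_cat : breaks D = filter not_over y ++ filter not_over z.
Proof. by rewrite -filter_cat -wE. Qed.

Lemma arc_ofE : arc_of y = size (filter not_over y) :> nat.
Proof. by rewrite inordK // breaks_cat size_cat ltnS leq_addr. Qed.

Lemma arc_of_take : take (arc_of y) (breaks D) = filter not_over y.
Proof. by rewrite arc_ofE breaks_cat take_size_cat. Qed.

Lemma arc_of_deg : arc_deg (arc_of y) = prefix_deg w y.
Proof.
by rewrite /arc_deg arc_of_take /deg_at_infinity /prefix_deg !foldl_next_deg_filter.
Qed.

Lemma arc_of_source : long_arc_source (arc_of y) = label (prefix_source u y).
Proof.
rewrite /long_arc_source arc_of_take -[breaks D]/(filter not_over w) !under_labels_filter.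
have -> : last 0%N (under_labels w) = label u.
  rewrite /w codeE /under_labels filter_cat map_cat last_cat /= lev_u /=.
  suff -> : [seq x <- w2 | lev x == Under] = [::] by [].
  by apply/eqP; rewrite -[_ == _]negbK -has_filter.
by rewrite /under_labels /prefix_source last_map.
Qed.

Lemma arc_of_value (c : T) x : x \in w -> lev x = Under ->
  (if long_arc_source (arc_of y) == label x
   then << c *g arc_deg (arc_of y) >> else 0 : laurent) =
  (<< c *g 0 >> : laurent) * arc_value (prefix_deg w y) (prefix_source u y) (inl x).
Proof.
move=> xw lx; rewrite arc_of_source arc_of_deg /arc_value.
have [sw lsrc] : prefix_source u y \in w /\ lev (prefix_source u y) = Under.
  have : prefix_source u y \in u :: filter is_under y by exact: mem_last.
  rewrite inE mem_filter => /orP [/eqP ->|/andP [/eqP -> yw]].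
    by rewrite /w codeE mem_cat mem_head orbT lev_u.
  by rewrite wE mem_cat yw.
have -> : unitv laurent (inl (prefix_source u y) : key) (inl x) =
    (label (prefix_source u y) == label x)%:R.
  rewrite /unitv; suff -> : (inl (prefix_source u y) == inl x :> key) =
      (label (prefix_source u y) == label x) by [].
  apply/eqP/eqP => [/inl_inj -> //|lbl].
  have [-> //|xE] := well_formed_same_label wf xw sw lbl.
  by move: lsrc; rewrite xE /= lx.
by case: eqP => _; rewrite ?mulr1 ?mulr0 // galgUU mulr1 add0r.
Qed.

End Prefix.
Section Row.
Variables (x : passage) (y z y' z' : seq passage).
Hypotheses (wE : w = y ++ x :: z) (lx : lev x = Under) (wE' : w = y' ++ mate x :: z').

Let yE : w = (y ++ [:: x]) ++ z. Proof. by rewrite -catA. Qed.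

Let under_y : {in y, forall k, ~~ at_level Under (label x) k}.
Proof. exact: no_at_level wf wE lx isT. Qed.

Let over_y' : {in y', forall k, ~~ at_level Over (label x) k}.
Proof. by apply: (no_at_level wf wE') => //=; rewrite lx. Qed.

Let here_under : at_level Under (label x) x. Proof. by rewrite /at_level lx !eqxx. Qed.
Let here_over : at_level Over (label x) (mate x). Proof. by rewrite /at_level /= lx !eqxx. Qed.

Let find_over : find (at_level Over (label x)) w = size y'.
Proof. by rewrite wE' find_here //; apply/hasPn. Qed.

Let find_under : find (at_level Under (label x)) w = size y.
Proof. by rewrite wE find_here //; apply/hasPn. Qed.

Let find_break : find (at_level Under (label x)) (breaks D) = size (filter not_over y).
Proof.
rewrite (breaks_cat wE) /= /not_over lx /= find_here //.
by apply/hasPn => k; rewrite mem_filter => /andP [_]; exact: under_y.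
Qed.

Lemma comes_intoE a : comes_into (label x) a = (a == arc_of y).
Proof. by rewrite /comes_into find_break -(arc_ofE wE). Qed.

Lemma emanatesE a : emanates (label x) a = (a == arc_of (y ++ [:: x])).
Proof.
rewrite /emanates find_break -(inj_eq val_inj) /= (arc_ofE yE).
by rewrite filter_cat size_cat /= /not_over lx addn1.
Qed.

Lemma passes_overE a : passes_over (label x) a = (a == arc_of y').
Proof.
rewrite /passes_over find_over -/w -(inj_eq val_inj) /= (arc_ofE wE') size_filter.
by rewrite [in take _ _]wE' take_size_cat.
Qed.

Lemma early_overE : early_over D (label x) = early w (label x).
Proof.
rewrite /early_over find_over find_under.
have Uw := well_formed_uniq wf.
have index_here k k1 k2 : w = k1 ++ k :: k2 -> index k w = size k1.
  move=> kE; move: Uw; rewrite kE cat_uniq /= negb_or => /and3P [_ /andP [kk _] _].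
  by rewrite index_cat (negPf kk) /= eqxx addn0.
have ix := index_here _ _ _ wE; have imx := index_here _ _ _ wE'.
have no_label k k1 k2 : w = k1 ++ k :: k2 -> mate k \notin k1 -> ~~ has (of_label (label k)) k1.
  move=> kE mk; have kw : k \in w by rewrite kE mem_cat mem_head orbT.
  apply/hasPn => j jk; apply/negP => /eqP lbl.
  have jw : j \in w by rewrite kE mem_cat jk.
  have [jE|jE] := well_formed_same_label wf kw jw lbl; last by rewrite -jE jk in mk.
  move: Uw; rewrite kE cat_uniq /= negb_or => /and3P [_ /andP [kk _] _].
  by rewrite -jE jk in kk.
case: (boolP (mate x \in y)) => my.
  have lt : (size y' < size y)%N by rewrite -imx wE index_cat my index_mem.
  rewrite lt {1}wE' -[label x]/(label (mate x)) early_here /= ?lx //.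
  apply: no_label wE' _; rewrite mateK; apply/negP => xy'.
  by move: lt; rewrite -ix wE' index_cat xy' ltnNge ltnW // index_mem.
have -> : (size y' < size y)%N = false.
  by apply: negbTE; rewrite -leqNgt -imx wE index_cat (negPf my) leq_addr.
by rewrite {1}wE early_here ?lx //; apply: no_label wE my.
Qed.

Lemma writheE : writhe D (label x) = sgz_bool (~~ l2r x).
Proof.
have xw : x \in w by rewrite wE mem_cat mem_head orbT.
rewrite /writhe /sgz_bool; congr (if _ then _ else _).
apply/hasP/idP => [[k kw /andP [/andP [/eqP lk /eqP lbl] gk]]|gx].
  have [kE|kE] := well_formed_same_label wf xw kw lbl; first by rewrite kE lx in lk.
  by rewrite kE in gk.
by exists (mate x); [rewrite -/w wE' mem_cat mem_head orbT | rewrite here_over].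
Qed.

Lemma t_powE : t_pow D (label x) = t_coef (early w (label x)) (~~ l2r x).
Proof. by rewrite /t_pow early_overE writheE. Qed.

(** At a classical crossing exactly one arc emanates, one passes over and one comes in. Their
    incidence coefficients 1, t - 1 and -t are those of the local equation, and their powers of s
    are the values found by elimination. *)
Lemma zeta_entry (val : key -> key -> laurent) x' :
    x' \in w -> lev x' = Under ->
    (forall y z, w = y ++ z ->
       val (last infinity (keys y)) =1 arc_value (prefix_deg w y) (prefix_source u y)) ->
  \sum_(a : diag_arc D | long_arc_source a == label x') << incidence (label x) a *g arc_deg a >> =
  reduced (key_coef t_mono s_mono (early w)) (key_cross t_mono s_mono (early w)) key_mate
    (prev_in infinity (keys w)) val (inl x) (inl x').
Proof.
move=> xw' lx' vals.
under eq_bigr => a _ do rewrite /incidence !monalgUD.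
rewrite !big_split /=.
rewrite (sum_single _ _ _ emanatesE) (sum_single _ _ _ passes_overE) (sum_single _ _ _ comes_intoE).
rewrite (arc_of_value yE) // (arc_of_value wE') // (arc_of_value wE) // t_powE.
have -> : arc_value (prefix_deg w (y ++ [:: x])) (prefix_source u (y ++ [:: x])) (inl x') =
    unitv laurent (inl x : key) (inl x').
  rewrite /prefix_deg /prefix_source foldl_cat filter_cat /= /is_under lx /= last_cat /=.
  by rewrite [next_deg _ x]/next_deg lx /arc_value -[<< 1 *g 0 >>]/(1 : laurent) mul1r.
have mE : w = (y' ++ [:: mate x]) ++ z' by rewrite -catA.
have /(_ (inl x')) := vals _ _ mE; rewrite map_cat last_cat /=.
have -> : prefix_deg w (y' ++ [:: mate x]) = prefix_deg w y'.
  by rewrite /prefix_deg foldl_cat /= [next_deg _ (mate x)]/next_deg /= lx.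
have -> : prefix_source u (y' ++ [:: mate x]) = prefix_source u y'.
  by rewrite /prefix_source filter_cat /= /is_under /= lx cats0.
have uq : uniq (infinity :: keys w) := uniq_keys wf.
have pE : prev_in infinity (keys w) (inl x) = last infinity (keys y).
  by apply: (@prev_inE _ _ (keys z) _ _ uq); rewrite wE map_cat.
move=> <-; rewrite -(vals _ _ wE) /reduced pE /= lx /=.
set e := early w (label x); set g := ~~ l2r x.
have -> : (<< t_coef e g - 1 *g 0 >> : laurent) = t_mono e g - 1 by exact: monalgUB.
have -> : (<< - t_coef e g *g 0 >> : laurent) = - t_mono e g by exact: monalgUN.
rewrite -[<< 1 *g 0 >>]/(1 : laurent) mul1r.
by rewrite -[t_mono e g - 1]opprB !mulNr addrAC.
Qed.

End Row.
End Diagram.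

(** * Zeta as the determinant of a word, and the bound *)

Lemma code_wf (D : diagram) : well_formed (code D).
Proof. by have /andP [] := codeP D. Qed.

(** Each classical crossing has a single underpass, so a numbering of the crossings lists the rows
    and columns left after elimination. A positive [n] provides the underpass at which the curve is
    cut. *)
Lemma zeta_wordE (D : diagram) n (v : n.-tuple nat) :
  perm_eq v (classical_crossings D) -> (0 < n)%N -> zeta D v = zeta_word (code D).
Proof.
move=> pv n0; have wf := code_wf D.
have hasU : has is_under (code D).
  rewrite has_filter; apply/eqP => U0; move: (perm_size pv) n0.
  by rewrite size_tuple /classical_crossings /under_labels -/(filter is_under (code D)) U0 => ->.
have [w1 [u [w2 [codeE lu nu]]]] := split_last_under hasU.
have wf' : well_formed (w1 ++ u :: w2) by rewrite -codeE.
have [val [vals zE]] := eliminated wf' lu nu; rewrite -codeE in vals zE; rewrite {}zE.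
set F := reduced _ _ _ _ _.
pose U := filter is_under (code D).
(* The underpass with label [l]; the default [u] is never reached for labels occurring in [v]. *)
pose x_of l := nth u U (index l (map label U)).
pose xs := map x_of v.
have x_ofK l : l \in v -> label (x_of l) = l.
  by rewrite (perm_mem pv) => lU;
    rewrite -(nth_map u 0%N) ?nth_index // -(size_map label) index_mem.
have U_uniq : uniq (map label U).
  rewrite map_inj_in_uniq ?filter_uniq ?well_formed_uniq // => x y.
  rewrite !mem_filter => /andP [/eqP ux xw] /andP [/eqP uy yw] lxy.
  by have [//|xE] := well_formed_same_label wf yw xw lxy; rewrite xE /= uy in ux.
have pU : perm_eq xs U.
  have -> : U = map x_of (map label U).
    apply: (@eq_from_nth _ u) => [|i iU]; first by rewrite !size_map.
    rewrite (nth_map 0%N) ?size_map // /x_of (nth_map u) // -(nth_map u 0%N) //.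
    by rewrite index_uniq // size_map.
  by apply: perm_map; exact: pv.
have sz : size (keys xs) = n by rewrite !size_map size_tuple.
rewrite (gdet_perm _ _ (perm_map inl (_ : perm_eq _ xs))) 1?perm_sym //.
rewrite /gdet sz /zeta; congr (\det _); apply/matrixP => i j; rewrite !mxE.
have szv k : (k < n)%N -> (k < size v)%N by rewrite size_tuple.
have xsE (k : 'I_n) : nth infinity (keys xs) k = inl (x_of (tnth v k)).
  by rewrite (nth_map u) ?size_map ?szv // (nth_map 0%N) ?szv // (tnth_nth 0%N).
have xU (k : 'I_n) : x_of (tnth v k) \in U by rewrite -(perm_mem pU) map_f ?mem_tnth.
have /[!mem_filter] /andP [/eqP ui iw] := xU i; have /[!mem_filter] /andP [/eqP uj jw] := xU j.
have [y [z wE]] : exists y z, code D = y ++ x_of (tnth v i) :: z.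
  by case/splitPr: iw => y z; exists y, z.
have [y' [z' wE']] : exists y z, code D = y ++ mate (x_of (tnth v i)) :: z.
  by have := well_formed_mate wf iw; case/splitPr => y' z'; exists y', z'.
by rewrite !xsE -[RHS](zeta_entry codeE lu nu wE ui wE' jw uj vals) !x_ofK ?mem_tnth.
Qed.

Lemma zeta_word_equivalent (D D' : diagram) : equivalent D D' ->
  exists2 cc : T * T, cc.1 * cc.2 = 1 &
    zeta_word (code D') = (<< cc.1 *g 0 >> : laurent) * zeta_word (code D).
Proof.
elim=> {D D'} [D D' mv|D|D D' _ [[a b] /= ab eqD]
  |D1 D2 D3 _ [[a b] /= ab eq12] _ [[c d] /= cd eq23]].
- exact: zeta_word_move (code_wf D) (code_wf D') mv.
- exists (1, 1) => /=; first exact: mulr1.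
  by rewrite -[X in X * _]/(1 : laurent) mul1r.
- exists (b, a) => /=; first by rewrite mulrC.
  by rewrite eqD mulrA galgUU [b * a]mulrC ab addr0 -[X in X * _]/(1 : laurent) mul1r.
exists (c * a, d * b) => /=; first by rewrite mulrACA cd ab mulr1.
by rewrite eq23 eq12 mulrA galgUU addr0.
Qed.

Theorem corollary1p1 (D : diagram) (n : nat) (v : n.-tuple nat)
  (v_numbers : perm_eq v (classical_crossings D)) (n_gt0 : (0 < n)%N)
  (deg_zeta : is_deg_s (zeta D v) (Posz (num_virtual D))) :
  forall D' : diagram, equivalent D D' -> (num_virtual D <= num_virtual D')%N.
Proof.
move=> D' /zeta_word_equivalent [[c c'] /= cc eqD'].
have [zeta_neq0 _] := deg_zeta; rewrite (zeta_wordE v_numbers n_gt0) in zeta_neq0.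
rewrite leqNgt; apply/negP => lt_virtual; case/eqP: zeta_neq0.
(* The left side is the coefficient of the determinant for [D'] at an exponent above its number of
   virtual crossings, so it vanishes. The inverse [c'] then cancels [c]. *)
have coef0 : c * (zeta_word (code D))@_(num_virtual D)%:Z = 0.
  rewrite -galg_coefUM -eqD'; apply: deg_le_zeta_word; rewrite ltz_nat.
  exact: leq_ltn_trans (count_virtual_l2r D') lt_virtual.
by rewrite -[LHS]mul1r -cc [c * c']mulrC -mulrA coef0 mulr0.
Qed.
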